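(* Let $Q_1(x,y)=x^6+y^6$ and $Q_2(x,y)=xy(x^4-y^4)$. A binary sextic form $p\in\mathbb{C}[x,y]$ has $N(p)>3$ if and only if $p$ is similar to $Q_1$ or to $Q_2$. Moreover $N(Q_1)=4$ and $N(Q_2)=6$; $Q_1$ is similar to $A_0$, $A_{15}$ and $B_0$; and $Q_2$ is similar to $A_{-5}$, $B_{5\sqrt{-2}}$ and $B_{-5\sqrt{-2}}$.
   Context: For $t\in\mathbb{C}$, $A_t(x,y)=x^6+tx^4y^2+tx^2y^4+y^6$ and $B_t(x,y)=x^6+tx^3y^3+y^6$. Two forms $p,p'\in\mathbb{C}[x,y]$ are similar if $p'=p\circ M$ for some invertible linear change $M(x,y)=(\alpha x+\beta y,\gamma x+\delta y)$, $\alpha\delta-\beta\gamma\ne0$. For a binary sextic $p$, $N(p)$ is the number of representations $p=f_1^3+f_2^3$ with $f_1,f_2\in\mathbb{C}[x,y]$ non-proportional quadratic forms, where two representations are counted as the same if the unordered pairs $\{f_1^3,f_2^3\}$ coincide. *)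

(* Defs.v *)
From mathcomp Require Import all_boot all_order all_algebra.
From mathcomp Require Import boolp classical_sets functions cardinality reals.
From mathcomp Require Import complex.
From mathcomp Require Import mpoly.

Set Implicit Arguments.
Unset Strict Implicit.
Unset Printing Implicit Defensive.

Import Order.TTheory GRing.Theory Num.Theory.

Local Open Scope classical_set_scope.
Local Open Scope ring_scope.
Local Open Scope complex_scope.

(* For R : realType, the field R[i] is the field of complex numbers. *)

Definition varx (R : realType) : {mpoly R[i][2]} := 'X_ord0.
Definition vary (R : realType) : {mpoly R[i][2]} := 'X_ord_max.

Definition sexticA (R : realType) (t : R[i]) : {mpoly R[i][2]} :=
  let x := varx R in let y := vary R in
  x ^+ 6 + t *: (x ^+ 4 * y ^+ 2) + t *: (x ^+ 2 * y ^+ 4) + y ^+ 6.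

Definition sexticB (R : realType) (t : R[i]) : {mpoly R[i][2]} :=
  let x := varx R in let y := vary R in
  x ^+ 6 + t *: (x ^+ 3 * y ^+ 3) + y ^+ 6.

Definition Q1 (R : realType) : {mpoly R[i][2]} :=
  let x := varx R in let y := vary R in x ^+ 6 + y ^+ 6.

Definition Q2 (R : realType) : {mpoly R[i][2]} :=
  let x := varx R in let y := vary R in x * y * (x ^+ 4 - y ^+ 4).

Definition similar_form (R : realType) (p p' : {mpoly R[i][2]}) : Prop :=
  exists a b c d : R[i], a * d - b * c != 0 /\
    p' = p \mPo [tuple a *: varx R + b *: vary R; c *: varx R + d *: vary R].

Definition proportional (R : realType) (f g : {mpoly R[i][2]}) : Prop :=
  exists a b : R[i], (a, b) != (0, 0) /\ a *: f = b *: g.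

(* A representation is recorded only through the unordered pair of its cubes,
   so N(p) is the cardinality of this set: N(p) = n reads reps p #= `I_n, and
   N(p) > n reads `I_n.+1 #<= reps p. *)
Definition reps (R : realType) (p : {mpoly R[i][2]}) :
    set (set {mpoly R[i][2]}) :=
  [set s | exists f1 f2 : {mpoly R[i][2]},
    [/\ f1 \is 2.-homog, f2 \is 2.-homog, ~ proportional f1 f2,
        p = f1 ^+ 3 + f2 ^+ 3 & s = [set f1 ^+ 3; f2 ^+ 3]]].

(* Main.v *)
(* Let w be a primitive cube root of unity. Since f^3 + g^3 = (f + g)(f + w g)(f + w^2 g),
   a representation of p amounts to a perfect matching of the six roots of p such that the
   three quadratic forms given by the pairs are pairwise non-proportional and linearly
   dependent, i.e. such that an involution of the projective line swaps the roots in each pair.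

   Among four of the 15 perfect matchings two are disjoint, and together they form a hexagon.
   A root shared by two pairs of a dependent triple lies in the third, so a repeated root would
   make the two representations equal; hence the roots are distinct. The product of the two
   involutions has order 3, so sending the vertices 0, 2, 4 of the hexagon to 1, w, w^2 turns p
   into a multiple of (x^3 - y^3)(x^3 - k^3 y^3). A matching other than the three which every
   such form has forces k = -1, which gives Q1, or (1 + k^3)^2 = -50 k^3, which gives Q2.
   The counts for Q1 and Q2 are obtained by testing the 15 matchings on explicit roots. *)

(* The set of the two cubes fixes f and g only up to order and cube roots of unity. These changes
   permute the factors f + w^j g up to scalars, so only unordered matchings matter, and [canonize]
   selects one list for each.

   Distinctness of the roots comes late, so a matching is first a matching of positions in a list of
   roots. A list of positions carries at most one representation, and this alone turns four
   representations into four matchings. That a representation has a single matching needs distinct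
   roots and serves only the counts.

   Why order 3: going two steps along the hexagon is the product of the two involutions, so it
   permutes the vertices 0, 2, 4 cyclically, and once these are 1, w, w^2 it is z |-> w z. The two
   involutions generate a copy of S_3, whose third involution exchanges opposite vertices. Every
   such hexagon thus has three admissible matchings, and only a fourth restricts k.

   Origin of -50: the fourth matching gives c + 1/c = -4 with c^3 = k^3, hence k^3 + 1/k^3 = -64 +
   12 = -52 and (1 + k^3)^2 / k^3 = -50. *)
From HB Require Import structures.
Require Import Defs.
From mathcomp Require Import all_boot all_order all_algebra.
From mathcomp Require Import boolp classical_sets functions cardinality reals.
From mathcomp Require Import complex.
From mathcomp Require Import mpoly.
From mathcomp Require Import ring zify.

Import Order.TTheory GRing.Theory Num.Theory.

(** * Perfect matchings of six indices *)

(* A list [:: a; b; c; d; e; f] stands for the matching with pairs ab, cd, ef. *)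
Definition swap0 (t : seq nat) :=
  if t is [:: a; b; c; d; e; f] then (if b < a then [:: b; a; c; d; e; f] else t) else t.
Definition swap1 (t : seq nat) :=
  if t is [:: a; b; c; d; e; f] then (if d < c then [:: a; b; d; c; e; f] else t) else t.
Definition swap2 (t : seq nat) :=
  if t is [:: a; b; c; d; e; f] then (if f < e then [:: a; b; c; d; f; e] else t) else t.
Definition swap01 (t : seq nat) :=
  if t is [:: a; b; c; d; e; f] then (if c < a then [:: c; d; a; b; e; f] else t) else t.
Definition swap12 (t : seq nat) :=
  if t is [:: a; b; c; d; e; f] then (if e < c then [:: a; b; e; f; c; d] else t) else t.
(** A sorting network: first inside each pair, then a bubble sort of the three pairs by their first
    entries. Each stage is the identity or one elementary exchange, so invariance can be proved
    stage by stage. *)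
Definition canonize t := swap01 (swap12 (swap01 (swap2 (swap1 (swap0 t))))).

(** The moves are involutions, so stability in one direction gives an equivalence. Exchanges inside
    the second and third pairs are conjugates of the exchange inside the first by the block
    moves. *)
Lemma canonize_iff (P : seq nat -> Prop) :
  (forall a b c d e f, P [:: a; b; c; d; e; f] -> P [:: b; a; c; d; e; f]) ->
  (forall a b c d e f, P [:: a; b; c; d; e; f] -> P [:: c; d; a; b; e; f]) ->
  (forall a b c d e f, P [:: a; b; c; d; e; f] -> P [:: a; b; e; f; c; d]) ->
  forall t, size t = 6 -> P (canonize t) <-> P t.
Proof.
move=> h0 h01 h12; pose good (s : seq nat -> seq nat) :=
  forall t, size t = 6 -> size (s t) = 6 /\ (P (s t) <-> P t).
have comp s s' : good s -> good s' -> good (fun t => s (s' t)).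
  by move=> hs hs' t /hs'[/hs[sz e] e']; split=> //; apply: iff_trans e e'.
have h1 a b c d e f : P [:: a; b; c; d; e; f] -> P [:: a; b; d; c; e; f].
  by move/h01/h0/h01.
have h2 a b c d e f : P [:: a; b; c; d; e; f] -> P [:: a; b; c; d; f; e].
  by move/h12/h1/h12.
have g0 : good swap0.
  case=> [|a [|b [|c [|d [|e [|f []]]]]]] // _; rewrite /swap0.
  by case: ifP => _; split=> //; split; apply: h0.
have g1 : good swap1.
  case=> [|a [|b [|c [|d [|e [|f []]]]]]] // _; rewrite /swap1.
  by case: ifP => _; split=> //; split; apply: h1.
have g2 : good swap2.
  case=> [|a [|b [|c [|d [|e [|f []]]]]]] // _; rewrite /swap2.
  by case: ifP => _; split=> //; split; apply: h2.
have g01 : good swap01.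
  case=> [|a [|b [|c [|d [|e [|f []]]]]]] // _; rewrite /swap01.
  by case: ifP => _; split=> //; split; apply: h01.
have g12 : good swap12.
  case=> [|a [|b [|c [|d [|e [|f []]]]]]] // _; rewrite /swap12.
  by case: ifP => _; split=> //; split; apply: h12.
move=> t szt.
by have [] := comp _ _ g01 (comp _ _ g12 (comp _ _ g01 (comp _ _ g2 (comp _ _ g1 g0)))) t szt.
Qed.

Definition matchings := [:: [:: 0; 1; 2; 3; 4; 5]; [:: 0; 1; 2; 4; 3; 5]; [:: 0; 1; 2; 5; 3; 4];
  [:: 0; 2; 1; 3; 4; 5]; [:: 0; 2; 1; 4; 3; 5]; [:: 0; 2; 1; 5; 3; 4];
  [:: 0; 3; 1; 2; 4; 5]; [:: 0; 3; 1; 4; 2; 5]; [:: 0; 3; 1; 5; 2; 4];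
  [:: 0; 4; 1; 2; 3; 5]; [:: 0; 4; 1; 3; 2; 5]; [:: 0; 4; 1; 5; 2; 3];
  [:: 0; 5; 1; 2; 3; 4]; [:: 0; 5; 1; 3; 2; 4]; [:: 0; 5; 1; 4; 2; 3]].

Lemma canonize_matchings I : perm_eq I (iota 0 6) -> canonize I \in matchings.
Proof.
rewrite -mem_permutations; move: I; apply/allP.
by vm_compute.
Qed.

Definition mate (m : seq nat) i := nth 0 m (let k := index i m in if odd k then k.-1 else k.+1).

Lemma all_in2 (T : eqType) (s : seq T) (P : T -> T -> bool) :
  all (fun m => all (P m) s) s -> {in s &, forall m m', P m m'}.
Proof. by move=> /allP h m m' /h/allP h' /h'. Qed.

Lemma mate_inj : {in matchings &, forall m m',
  all (fun i => mate m i == mate m' i) (iota 0 6) -> m = m'}.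
Proof.
pose P m m' := all (fun i => mate m i == mate m' i) (iota 0 6) ==> (m == m').
have h : {in matchings &, forall m m', P m m'} by apply: all_in2; vm_compute.
by move=> m m' hm hm' e; apply/eqP; move: (h m m' hm hm'); rewrite /P e.
Qed.

Definition disj m m' := all (fun i => mate m i != mate m' i) (iota 0 6).

(** The union of two disjoint perfect matchings splits into even cycles of length at least 4, so on
    six points it is one hexagon, here walked from 0 along sides taken alternately from [m] and
    [m']. *)
Definition hexagon m m' :=
  let b := mate m 0 in let c := mate m' b in let d := mate m c in let e := mate m' d in
  [:: 0; b; c; d; e; mate m e].

(* With the vertices of a hexagon numbered cyclically, these are, up to its symmetries, the
   matchings other than the two formed by its sides and the one by its main diagonals. *)
Definition patterns := [:: [:: 0; 1; 2; 5; 4; 3]; [:: 0; 2; 4; 1; 3; 5]; [:: 0; 2; 4; 3; 1; 5]].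

Definition pattern (t : seq nat) k := [seq nth 0 t i | i <- nth [::] patterns k].

(** The long diagonals of the hexagon, to be excluded because they are admissible for every k,
    through z |-> k w^2 / z. *)
Definition third m m' := canonize [seq nth 0 (hexagon m m') i | i <- [:: 0; 3; 1; 4; 2; 5]].

(** Rotations by even steps keep the sides of [m] and of [m'] apart, and [hexagon m' m] is the same
    hexagon walked backwards. Under these symmetries the three patterns yield 3 + 3 + 6 = 12
    matchings, that is, all but the two side matchings and [third]. *)
Definition candidates m m' :=
  [seq canonize (pattern (rot (2 * j) (hexagon m m')) k) | j <- iota 0 3, k <- iota 0 3].

Lemma hexagonP : {in matchings &, forall m m', disj m m' -> forall j, j < 3 ->
  canonize (rot (2 * j) (hexagon m m')) = m /\ canonize (rot 1 (rot (2 * j) (hexagon m m'))) = m'}.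
Proof.
pose Q m m' j := (canonize (rot (2 * j) (hexagon m m')) == m) &&
                 (canonize (rot 1 (rot (2 * j) (hexagon m m'))) == m').
pose P m m' := disj m m' ==> all (Q m m') (iota 0 3).
have h : {in matchings &, forall m m', P m m'} by apply: all_in2; vm_compute.
move=> m m' hm hm' d j j3; move: (h m m' hm hm'); rewrite /P d implyTb => /allP hQ.
have : Q m m' j by apply: hQ; rewrite mem_iota.
by move=> /andP[/eqP ? /eqP ?].
Qed.

Lemma candidatesP : {in matchings & &, forall m m' n, disj m m' -> n \notin [:: m; m'; third m m']
    ->
  n \in candidates m m' ++ candidates m' m}.
Proof.
pose P m m' := disj m m' ==>
  all (mem ([:: m; m'; third m m'] ++ (candidates m m' ++ candidates m' m))) matchings.
have h : {in matchings &, forall m m', P m m'} by apply: all_in2; vm_compute.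
have dropl (n : seq nat) (s1 s2 : seq (seq nat)) : n \in s1 ++ s2 -> n \notin s1 -> n \in s2.
  by rewrite mem_cat => /orP[->|].
move=> m m' n hm hm' hn d; move: (h m m' hm hm'); rewrite /P d implyTb => /allP hQ.
exact: (dropl _ _ _ (hQ n hn)).
Qed.

(** The bound of Erdos-Ko-Rado type for perfect matchings of six points: a pairwise meeting family
    has at most three members, as many as contain a given pair. Verified by enumeration. *)
Lemma meeting_matchings : {in matchings &, forall m1 m2, {in matchings &, forall m3 m4,
  uniq [:: m1; m2; m3; m4] ->
  [|| disj m1 m2, disj m1 m3, disj m2 m3, disj m1 m4, disj m2 m4 | disj m3 m4]}}.
Proof.
pose Q m1 m2 m3 m4 := [|| m1 == m4, m2 == m4, m3 == m4, disj m1 m4, disj m2 m4 | disj m3 m4].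
pose Q3 m1 m2 m3 := [|| m1 == m3, m2 == m3, disj m1 m3, disj m2 m3 | all (Q m1 m2 m3) matchings].
pose P m1 m2 := [|| m1 == m2, disj m1 m2 | all (Q3 m1 m2) matchings].
have h : {in matchings &, forall m m', P m m'} by apply: all_in2; vm_compute.
move=> m1 m2 h1 h2 m3 m4 h3 h4; rewrite /= !inE !negb_or andbT -!andbA.
move=> /and5P[/negPf n12 /negPf n13 /negPf n14 /negPf n23 /andP[/negPf n24 /negPf n34]].
move: (h m1 m2 h1 h2); rewrite /P n12 orFb => /orP[->//|/allP/(_ m3 h3)].
rewrite /Q3 n13 n23 !orFb => /or3P[->|->|/allP/(_ m4 h4)]; rewrite ?orbT //.
by rewrite /Q n14 n24 n34 !orFb => /or3P[->|->|->]; rewrite ?orbT.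
Qed.

Lemma four_matchings (M : seq (seq nat)) : {subset M <= matchings} -> uniq M -> size M = 4 ->
  exists t k, [/\ size t = 6, k < 3 & [/\ canonize t \in M, canonize (rot 1 t) \in M,
    canonize t != canonize (rot 1 t) & canonize (pattern t k) \in M]].
Proof.
move=> sM uM szM.
have [m [m' [mM mM' d]]] : exists m m', [/\ m \in M, m' \in M & disj m m'].
  case: M szM uM sM => [|m1 [|m2 [|m3 [|m4 []]]]] // _ uM sM.
  have := meeting_matchings _ _ (sM m1 _) (sM m2 _) _ _ (sM m3 _) (sM m4 _) uM.
  rewrite !inE !eqxx !orbT => /(_ isT isT isT isT).
  by case/or4P=> [|||/or3P[]] d; [exists m1, m2|exists m1, m3|exists m2, m3|exists m1, m4|exists
      m2, m4|exists m3, m4];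
     rewrite !inE !eqxx ?orbT.
have dC : disj m' m by rewrite /disj; under eq_all do rewrite eq_sym.
have ne : m != m' by apply/eqP => e; move: d; rewrite e /disj /= eqxx.
(* Three matchings are allowed for every hexagon, so the fourth member of [M] supplies a genuine
   pattern. *)
have [n nM nn] : exists2 n, n \in M & n \notin [:: m; m'; third m m'].
  apply/hasP; apply/negPn/negP; rewrite -all_predC => /allP h.
  have /(uniq_leq_size uM) : {subset M <= [:: m; m'; third m m']}.
    by move=> n /h /=; rewrite negbK.
  by rewrite szM.
have : n \in candidates m m' ++ candidates m' m by apply: candidatesP => //; exact: sM.
have key u v : u \in M -> v \in M -> u != v -> disj u v -> n \in candidates u v -> exists t k,
    [/\ size t = 6, k < 3 & [/\ canonize t \in M, canonize (rot 1 t) \in M,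
    canonize t != canonize (rot 1 t) & canonize (pattern t k) \in M]].
  move=> uM' vM uv duv /allpairsP[[j k] [hj hk nE]].
  have j3 : j < 3 by move: hj; rewrite mem_iota.
  have k3 : k < 3 by move: hk; rewrite mem_iota.
  rewrite [(j, k).1]/= [(j, k).2]/= in nE.
  exists (rot (2 * j) (hexagon u v)), k.
  have [-> ->] := hexagonP _ _ (sM _ uM') (sM _ vM) duv _ j3.
  by rewrite -nE size_rot; split=> //; split.
by rewrite mem_cat => /orP[]; apply: key; rewrite // eq_sym.
Qed.

Lemma matchings_perm : {in matchings, forall m, perm_eq m (iota 0 6)}.
Proof. by apply/allP. Qed.

(** Here [b_i] means that vertex i carries a given repeated root. Two such vertices lie in different
    pairs of at least one side matching, whose third pair is then hit too; three hit vertices meet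
    at least two pairs of the other side matching, hence all three. *)
Lemma hexagon_cover (b0 b1 b2 b3 b4 b5 : bool) : (2 <= b0 + b1 + b2 + b3 + b4 + b5) ->
  [&& (b0 || b1) && (b2 || b3) ==> b4 || b5, (b0 || b1) && (b4 || b5) ==> b2 || b3
    & (b2 || b3) && (b4 || b5) ==> b0 || b1] ->
  [&& (b1 || b2) && (b3 || b4) ==> b5 || b0, (b1 || b2) && (b5 || b0) ==> b3 || b4
    & (b3 || b4) && (b5 || b0) ==> b1 || b2] ->
  [&& b0 || b1, b2 || b3 & b4 || b5] && [&& b1 || b2, b3 || b4 & b5 || b0].
Proof. by case: b0; case: b1; case: b2; case: b3; case: b4; case: b5. Qed.

Local Open Scope classical_set_scope.
Local Open Scope card_scope.
Local Open Scope ring_scope.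
Local Open Scope complex_scope.

Lemma set2_eq {T : Type} {a b a' b' : T} : [set a; b]%classic = [set a'; b']%classic ->
  (a = a' /\ b = b') \/ (a = b' /\ b = a').
Proof.
move=> e.
have [a1|a1] : [set a'; b']%classic a by rewrite -e; left.
  have [b1|b1] : [set a'; b']%classic b by rewrite -e; right.
    have [b2|b2] : [set a; b]%classic b' by rewrite e; right.
      by left; rewrite a1 b1 b2 a1.
    by left; rewrite a1 b2.
  by left.
have [b1|b1] : [set a'; b']%classic b by rewrite -e; right.
  by right.
have [b2|b2] : [set a; b]%classic a' by rewrite e; left.
  by right; rewrite a1 b1 b2 a1.
by right; rewrite a1 b2.
Qed.

Lemma seq3_perm_ind {T : eqType} (P : seq T -> Prop) :
  (forall a b c, P [:: a; b; c] -> P [:: b; a; c]) ->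
  (forall a b c, P [:: a; b; c] -> P [:: a; c; b]) ->
  forall u v, size v = 3%N -> perm_eq u v -> P v -> P u.
Proof.
move=> h0 h1 u v szv puv hP; have szu := perm_size puv; rewrite szv in szu.
case: v szv puv hP => [|a [|b [|c []]]] // _ puv hP.
case: u szu puv => [|a' [|b' [|c' []]]] // _ puv.
have two (d e d' e' : T) : perm_eq [:: d; e] [:: d'; e'] -> [:: d; e] = [:: d'; e'] \/ [:: d; e] =
    [:: e'; d'].
  move=> p; have : d \in [:: d'; e'] by rewrite -(perm_mem p) mem_head.
  rewrite !inE => /orP[] /eqP dE; rewrite dE in p *.
    by move: p; rewrite perm_cons => /perm_small_eq -> //; left.
  have : perm_eq [:: e'; e] [:: e'; d'].
    by apply: perm_trans p _; apply/permP => q /=; lia.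
  by rewrite perm_cons => /perm_small_eq -> //; right.
have : a' \in [:: a; b; c] by rewrite -(perm_mem puv) mem_head.
rewrite !inE => /or3P[] /eqP aE; rewrite aE in puv *.
- by move: puv; rewrite perm_cons => /two[] [-> ->] //; apply: h1.
- have : perm_eq [:: b; b'; c'] [:: b; a; c] by apply: perm_trans puv _; apply/permP => q /=; lia.
  by rewrite perm_cons => /two[] [-> ->]; [apply: h0|apply/h1/h0].
- have : perm_eq [:: c; b'; c'] [:: c; a; b] by apply: perm_trans puv _; apply/permP => q /=; lia.
  by rewrite perm_cons => /two[] [-> ->]; [apply/h0/h1|apply/h1/h0/h1].
Qed.

(* [ring] cannot use hypotheses: here k is the cofactor of the relation e = 0. *)
Lemma eq_modulo {A : comPzRingType} (k : A) {e a b : A} : e = 0 -> a - b = k * e -> a = b.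
Proof. by move=> -> /eqP; rewrite mulr0 subr_eq0 => /eqP. Qed.

(** * Dependent triples of quadratics and involutions of the line *)

(* The determinant of the coefficients of (X - t0)(X - t1), (X - t2)(X - t3), (X - t4)(X - t5). *)
Definition syzygy_det {F : pzRingType} (t : seq F) : F :=
  let s1 := t`_2 + t`_3 - (t`_0 + t`_1) in let s2 := t`_4 + t`_5 - (t`_0 + t`_1) in
  let p1 := t`_2 * t`_3 - t`_0 * t`_1 in let p2 := t`_4 * t`_5 - t`_0 * t`_1 in
  s1 * p2 - s2 * p1.

(** The values at 0, 1 and -1 isolate the three coefficients of the relation; the division by 2 uses
    characteristic 0. *)
Lemma syzygy_det_eq0 {F : numFieldType} {t : seq F} {e0 e1 e2 : F} : e1 != 0 ->
  (forall z, e0 * ((z - t`_0) * (z - t`_1)) + e1 * ((z - t`_2) * (z - t`_3)) +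
   e2 * ((z - t`_4) * (z - t`_5)) = 0) -> syzygy_det t = 0.
Proof.
rewrite /syzygy_det; move: t`_0 t`_1 t`_2 t`_3 t`_4 t`_5 => a b c d e f e1n0 h.
have two : 2 != 0 :> F by rewrite pnatr_eq0.
pose X z := e0 * ((z - a) * (z - b)) + e1 * ((z - c) * (z - d)) + e2 * ((z - e) * (z - f)).
have X0 z : X z = 0 by exact: h.
have E0 : e0 + e1 + e2 = 0.
  apply: (mulfI two); transitivity (X 1 + X (- 1) - 2 * X 0); first by rewrite /X; ring.
  by rewrite !X0 !mulr0 subr0 addr0.
have P0 : e0 * (a * b) + e1 * (c * d) + e2 * (e * f) = 0 by rewrite -[RHS](X0 0) /X; ring.
have S0 : e0 * (a + b) + e1 * (c + d) + e2 * (e + f) = 0.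
  apply: (mulfI two); transitivity (X (- 1) - X 1); first by rewrite /X; ring.
  by rewrite !X0 mulr0 subr0.
apply: (mulfI e1n0); rewrite mulr0.
rewrite [LHS](_ : _ = (e0 * (a + b) + e1 * (c + d) + e2 * (e + f) - (a + b) * (e0 + e1 + e2)) * (e
    * f - a * b)
  - (e + f - (a + b)) * (e0 * (a * b) + e1 * (c * d) + e2 * (e * f) - (a * b) * (e0 + e1 + e2)));
      last by ring.
by rewrite E0 P0 S0; ring.
Qed.

(** Each pair gives a point (sum, product). The three points are distinct because the pairs have
    disjoint roots, and the determinant says that they are collinear. The coefficients are
    differences of one coordinate, which is injective on the line: the product if all sums agree,
    the sum otherwise. *)
Lemma syzygy_of_det {F : fieldType} (a b c d e f : F) : uniq [:: a; b; c; d; e; f] ->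
  syzygy_det [:: a; b; c; d; e; f] = 0 ->
  exists e0 e1 e2, [/\ e0 != 0, e1 != 0 & e2 != 0] /\
    [/\ e0 + e1 + e2 = 0, e0 * (a + b) + e1 * (c + d) + e2 * (e + f) = 0 &
        e0 * (a * b) + e1 * (c * d) + e2 * (e * f) = 0].
Proof.
rewrite /= !inE !negb_or -!andbA => /and5P[ab ac ad ae /and5P[af bc bd be /and5P[bf cd ce cf
    /and4P[de df ef _]]]].
have quad (u v u' v' : F) : u != u' -> u != v' -> u + v = u' + v' -> u * v != u' * v'.
  move=> uu' uv' s; apply: contra_neqN uu' => /eqP m; apply/eqP.
  have : (u - u') * (u - v') = 0.
    have -> : (u - u') * (u - v') = u * (u + v) - u * (u' + v') + (u' * v' - u * v) by ring.
    by rewrite s m !subrr addr0.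
  by move/eqP; rewrite mulf_eq0 !subr_eq0 (negPf uv') orbF.
rewrite /syzygy_det /= => D0.
have [s01|s01] := eqVneq (a + b) (c + d).
  have p01 := quad _ _ _ _ ac ad s01.
  have s02 : a + b = e + f.
    apply/eqP; rewrite eq_sym -subr_eq0; apply/eqP.
    have pn : c * d - a * b != 0 by rewrite subr_eq0 eq_sym.
    by apply: (mulIf pn); rewrite mul0r -[RHS]oppr0 -D0 -s01; ring.
  have p02 := quad _ _ _ _ ae af s02.
  have p12 : c * d != e * f by apply: quad; rewrite // -s01.
  exists (c * d - e * f), (e * f - a * b), (a * b - c * d); split.
    by split; rewrite subr_eq0 // eq_sym.
  by split; rewrite -?s01 -?s02; ring.
have s02 : a + b != e + f.
  apply/eqP => s02; have /eqP := quad _ _ _ _ ae af s02; apply.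
  have sn : c + d - (a + b) != 0 by rewrite subr_eq0 eq_sym.
  apply/eqP; rewrite eq_sym -subr_eq0; apply/eqP/(mulfI sn).
  by rewrite mulr0 -[RHS]D0 -s02; ring.
have s12 : c + d != e + f.
  apply/eqP => s12; have /eqP := quad _ _ _ _ ce cf s12; apply.
  have sn : c + d - (a + b) != 0 by rewrite subr_eq0 eq_sym.
  apply/eqP; rewrite eq_sym -subr_eq0; apply/eqP/(mulfI sn).
  by rewrite mulr0 -[RHS]D0 -s12; ring.
exists (c + d - (e + f)), (e + f - (a + b)), (a + b - (c + d)); split.
  by split; rewrite subr_eq0 // eq_sym.
split; [ring|ring|by rewrite -[RHS]oppr0 -D0; ring].
Qed.

(* (A, B, C) is the involution z |-> - (B z + C) / (A z + B) exchanging the roots in each pair. *)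
Lemma syzygy_det_annihilator {F : fieldType} (a b c d e f : F) : uniq [:: a; b; c; d; e; f] ->
  syzygy_det [:: a; b; c; d; e; f] = 0 ->
  exists A B C, [/\ A * C - B ^+ 2 != 0, A * (a * b) + B * (a + b) + C = 0,
    A * (c * d) + B * (c + d) + C = 0 & A * (e * f) + B * (e + f) + C = 0].
Proof.
rewrite /= !inE !negb_or -!andbA => /and5P[ab ac ad ae /and5P[af bc bd be _]].
rewrite /syzygy_det /= => D0.
(* The line A p + B s + C = 0 through the first two points (s, p) = (sum, product); the determinant
   puts the third point on it. *)
pose A := c + d - (a + b); pose B := a * b - c * d; pose C := - (A * (a * b) + B * (a + b)).
have E0 : A * (a * b) + B * (a + b) + C = 0 by rewrite subrr.
have E1 : A * (c * d) + B * (c + d) + C = 0 by rewrite /C /A /B; ring.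
exists A, B, C; split=> //; last by rewrite -[RHS]D0 /C /A /B; ring.
(* A degenerate (A, B, C) gives (A u + B)(A v + B) = 0 for each pair u, v, so two pairs would share
   the root -B/A; if A = 0, then B = 0 and the first two quadratics coincide. *)
apply/negP => /eqP AC.
have fact u v : A * (u * v) + B * (u + v) + C = 0 -> (A * u + B) * (A * v + B) = 0.
  move=> h; rewrite [LHS](_ : _ = A * (A * (u * v) + B * (u + v) + C) - (A * C - B ^+ 2)); last by
      ring.
  by rewrite h AC mulr0 subr0.
have [A0|An0] := eqVneq A 0.
  have B0 : B = 0 by apply/eqP; rewrite -sqrf_eq0 -[B ^+ 2](subKr (A * C)) AC A0 mul0r subr0.
  have : (a - c) * (a - d) = 0.
    by rewrite [LHS](_ : _ = - a * A - B); [rewrite A0 B0 mulr0 subr0|rewrite /A /B; ring].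
  by move/eqP; rewrite mulf_eq0 !subr_eq0 (negPf ac) (negPf ad).
have inj u v : A * u + B = 0 -> A * v + B = 0 -> u = v.
  by move=> hu hv; apply: (mulfI An0); apply: (addIr B); rewrite hu hv.
have /eqP := fact _ _ E0; have /eqP := fact _ _ E1; rewrite !mulf_eq0.
by move=> /orP[] /eqP h1 /orP[] /eqP h0; have := inj _ _ h0 h1 => /eqP; apply/negP.
Qed.

(** Eliminating C gives A D = 0 and B D = 0 for the determinant D, hence (A C - B^2) D = 0 with no
    case distinction on A. *)
Lemma annihilator_syzygy_det {F : idomainType} (t : seq F) (A B C : F) : A * C - B ^+ 2 != 0 ->
  A * (t`_0 * t`_1) + B * (t`_0 + t`_1) + C = 0 -> A * (t`_2 * t`_3) + B * (t`_2 + t`_3) + C = 0 ->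
  A * (t`_4 * t`_5) + B * (t`_4 + t`_5) + C = 0 -> syzygy_det t = 0.
Proof.
rewrite /syzygy_det; move: t`_0 t`_1 t`_2 t`_3 t`_4 t`_5 => a b c d e f AC E0 E1 E2.
set D := LHS.
have AD : A * D = 0.
  rewrite [LHS](_ : _ = (c + d - (a + b)) * (A * (e * f) + B * (e + f) + C - (A * (a * b) + B * (a
      + b) + C)) -
    (e + f - (a + b)) * (A * (c * d) + B * (c + d) + C - (A * (a * b) + B * (a + b) + C))); last by
        rewrite /D; ring.
  by rewrite E0 E1 E2 !subrr !mulr0 subrr.
have BD : B * D = 0.
  rewrite [LHS](_ : _ = (e * f - a * b) * (A * (c * d) + B * (c + d) + C - (A * (a * b) + B * (a +
      b) + C)) -
    (c * d - a * b) * (A * (e * f) + B * (e + f) + C - (A * (a * b) + B * (a + b) + C))); last by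
        rewrite /D; ring.
  by rewrite E0 E1 E2 !subrr !mulr0 subrr.
by apply: (mulfI AC); rewrite mulr0 mulrBl mulrAC AD mul0r expr2 -mulrA BD mulr0 subr0.
Qed.

(** * Explicit hexagon and octahedron: certificates for the 15 determinants *)

(* The hexagon for which the two matchings by its sides are z |-> k / z and z |-> k w / z. *)
Definition hexagon_roots {F : pzRingType} (w k : F) := [:: 1; k; w; k * w ^+ 2; w ^+ 2; k * w].

Lemma eq_modulo2 {A : comPzRingType} (k1 k2 : A) {e1 e2 a b : A} :
  e1 = 0 -> e2 = 0 -> a - b = k1 * e1 + k2 * e2 -> a = b.
Proof. by move=> -> -> /eqP; rewrite !mulr0 addr0 subr_eq0 => /eqP. Qed.

(** A certificate of nonvanishing for numbers given by polynomial relations: the cofactor [e], found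
    like an inverse in the number ring, brings [a] to a positive integer. *)
Lemma neq0_of_mul {F : numFieldType} (n : nat) {a e : F} : (0 < n)%N -> a * e = n%:R -> a != 0.
Proof.
move=> n0 h; apply/eqP => a0; have /eqP := h.
by rewrite a0 mul0r eq_sym pnatr_eq0 eqn0Ngt n0.
Qed.

(* For i^2 = -1 and s^2 = 2, the roots of A_(-5) in an order for which the two matchings of
   the hexagon and the second element of [patterns] are all admissible. *)
Definition octahedron {F : pzRingType} (i s : F) := [:: i; 1 + s; s - 1; - 1 - s; 1 - s; - i].

(** The six zeros correspond to the half-turns of the octahedron about axes through midpoints of
    opposite edges; the three half-turns about its diagonals fix two vertices and give no
    matching. *)
Lemma count_octahedron {F : numFieldType} (i s : F) : i ^+ 2 + 1 = 0 -> s ^+ 2 - 2 = 0 ->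
  count (fun m => syzygy_det [seq (octahedron i s)`_j | j <- m] == 0) matchings = 6%N.
Proof.
move=> iE sE; rewrite /matchings /=.
have -> : syzygy_det [:: i; 1 + s; s - 1; - 1 - s; 1 - s; - i] == 0.
  by apply/eqP; rewrite /syzygy_det /=; apply: (eq_modulo2 (- 2 * s) (- 4 * i - 2 * s) iE sE); ring.
have /negPf -> : syzygy_det [:: i; 1 + s; s - 1; 1 - s; - 1 - s; - i] != 0.
  apply: (neq0_of_mul 40 (e := 1 + 3 * i)) => //.
  by rewrite /syzygy_det /=; apply: (eq_modulo2 (- 14 - 6 * i - 6 * i * s - 2 * s - 12 * s ^+ 2)
      (14 + 2 * i - 6 * i * s - 2 * s) iE sE); ring.
have /negPf -> : syzygy_det [:: i; 1 + s; s - 1; - i; - 1 - s; 1 - s] != 0.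
  apply: (neq0_of_mul 40 (e := - 1 + 3 * i)) => //.
  by rewrite /syzygy_det /=; apply: (eq_modulo2 (10 + 6 * i - 24 * s ^+ 2) (26 + 2 * i) iE sE);
      ring.
have /negPf -> : syzygy_det [:: i; s - 1; 1 + s; - 1 - s; 1 - s; - i] != 0.
  apply: (neq0_of_mul 40 (e := - 1 + 3 * i)) => //.
  by rewrite /syzygy_det /=; apply: (eq_modulo2 (- 14 + 6 * i - 6 * i * s + 2 * s - 12 * s ^+ 2)
      (14 - 2 * i - 6 * i * s + 2 * s) iE sE); ring.
have -> : syzygy_det [:: i; s - 1; 1 + s; 1 - s; - 1 - s; - i] == 0.
  by apply/eqP; rewrite /syzygy_det /=; apply: (eq_modulo2 (- 2 * s) (- 4 * i - 2 * s) iE sE); ring.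
have /negPf -> : syzygy_det [:: i; s - 1; 1 + s; - i; - 1 - s; 1 - s] != 0.
  apply: (neq0_of_mul 40 (e := 1 + 3 * i)) => //.
  by rewrite /syzygy_det /=; apply: (eq_modulo2 (10 - 6 * i - 24 * s ^+ 2) (26 - 2 * i) iE sE);
      ring.
have /negPf -> : syzygy_det [:: i; - 1 - s; 1 + s; s - 1; 1 - s; - i] != 0.
  apply: (neq0_of_mul 40 (e := - 1 - 3 * i)) => //.
  by rewrite /syzygy_det /=; apply: (eq_modulo2 (10 - 6 * i - 24 * s ^+ 2) (26 - 2 * i) iE sE);
      ring.
have -> : syzygy_det [:: i; - 1 - s; 1 + s; 1 - s; s - 1; - i] == 0.
  by apply/eqP; rewrite /syzygy_det /=; apply: (eq_modulo2 (2 * s) (- 4 * i + 2 * s) iE sE); ring.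
have /negPf -> : syzygy_det [:: i; - 1 - s; 1 + s; - i; s - 1; 1 - s] != 0.
  apply: (neq0_of_mul 40 (e := 1 - 3 * i)) => //.
  by rewrite /syzygy_det /=; apply: (eq_modulo2 (- 14 + 6 * i + 6 * i * s - 2 * s - 12 * s ^+ 2)
      (14 - 2 * i + 6 * i * s - 2 * s) iE sE); ring.
have /negPf -> : syzygy_det [:: i; 1 - s; 1 + s; s - 1; - 1 - s; - i] != 0.
  apply: (neq0_of_mul 40 (e := 1 - 3 * i)) => //.
  by rewrite /syzygy_det /=; apply: (eq_modulo2 (10 + 6 * i - 24 * s ^+ 2) (26 + 2 * i) iE sE);
      ring.
have /negPf -> : syzygy_det [:: i; 1 - s; 1 + s; - 1 - s; s - 1; - i] != 0.
  apply: (neq0_of_mul 40 (e := 1 + 3 * i)) => //.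
  by rewrite /syzygy_det /=; apply: (eq_modulo2 (- 14 - 6 * i + 6 * i * s + 2 * s - 12 * s ^+ 2)
      (14 + 2 * i + 6 * i * s + 2 * s) iE sE); ring.
have -> : syzygy_det [:: i; 1 - s; 1 + s; - i; s - 1; - 1 - s] == 0.
  by apply/eqP; rewrite /syzygy_det /=; apply: (eq_modulo2 (- 2 * s) (4 * i - 2 * s) iE sE); ring.
have -> : syzygy_det [:: i; - i; 1 + s; s - 1; - 1 - s; 1 - s] == 0.
  by apply/eqP; rewrite /syzygy_det /=; apply: (eq_modulo2 (4 * s) (4 * s) iE sE); ring.
have -> : syzygy_det [:: i; - i; 1 + s; - 1 - s; s - 1; 1 - s] == 0.
  by apply/eqP; rewrite /syzygy_det /=; apply: (eq_modulo2 (0) (0) iE sE); ring.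
have /negPf -> : syzygy_det [:: i; - i; 1 + s; 1 - s; s - 1; - 1 - s] != 0.
  apply: (neq0_of_mul 8 (e := - 1)) => //.
  by rewrite /syzygy_det /=; apply: (eq_modulo2 (- 4) (4) iE sE); ring.
by [].
Qed.

(** For k = -1 the points are the sixth roots of unity. The four zeros are the involutions z |-> -
    w^j / z for j = 0, 1, 2 and the extra one z |-> - z. *)
Lemma count_hexagon {F : numFieldType} (w : F) : w ^+ 2 + w + 1 = 0 ->
  count (fun m => syzygy_det [seq (hexagon_roots w (- 1))`_j | j <- m] == 0) matchings = 4%N.
Proof.
move=> wE; rewrite /matchings /=.
have -> : syzygy_det [:: 1; - 1; w; - 1 * w ^+ 2; w ^+ 2; - 1 * w] == 0.
  by apply/eqP; rewrite /syzygy_det /=; apply: (eq_modulo (2 * w - 4 * w ^+ 2 + 2 * w ^+ 3) wE);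
      ring.
have /negPf -> : syzygy_det [:: 1; - 1; w; w ^+ 2; - 1 * w ^+ 2; - 1 * w] != 0.
  apply: (neq0_of_mul 4 (e := - 1)) => //.
  by rewrite /syzygy_det /=; apply: (eq_modulo (- 4 + 2 * w - 2 * w ^+ 3) wE); ring.
have -> : syzygy_det [:: 1; - 1; w; - 1 * w; - 1 * w ^+ 2; w ^+ 2] == 0.
  by apply/eqP; rewrite /syzygy_det /=; apply: (eq_modulo (0) wE); ring.
have /negPf -> : syzygy_det [:: 1; w; - 1; - 1 * w ^+ 2; w ^+ 2; - 1 * w] != 0.
  apply: (neq0_of_mul 5 (e := 1)) => //.
  by rewrite /syzygy_det /=; apply: (eq_modulo (- 5 + 6 * w - w ^+ 2 + w ^+ 3) wE); ring.
have /negPf -> : syzygy_det [:: 1; w; - 1; w ^+ 2; - 1 * w ^+ 2; - 1 * w] != 0.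
  apply: (neq0_of_mul 5 (e := - 1)) => //.
  by rewrite /syzygy_det /=; apply: (eq_modulo (- 5 + 4 * w + 3 * w ^+ 2 - w ^+ 3) wE); ring.
have /negPf -> : syzygy_det [:: 1; w; - 1; - 1 * w; - 1 * w ^+ 2; w ^+ 2] != 0.
  apply: (neq0_of_mul 4 (e := - 1)) => //.
  by rewrite /syzygy_det /=; apply: (eq_modulo (- 4 + 2 * w - 2 * w ^+ 3) wE); ring.
have /negPf -> : syzygy_det [:: 1; - 1 * w ^+ 2; - 1; w; w ^+ 2; - 1 * w] != 0.
  apply: (neq0_of_mul 9 (e := 1)) => //.
  by rewrite /syzygy_det /=; apply: (eq_modulo (- 9 + 8 * w - w ^+ 2 - w ^+ 3) wE); ring.
have -> : syzygy_det [:: 1; - 1 * w ^+ 2; - 1; w ^+ 2; w; - 1 * w] == 0.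
  by apply/eqP; rewrite /syzygy_det /=; apply: (eq_modulo (0) wE); ring.
have /negPf -> : syzygy_det [:: 1; - 1 * w ^+ 2; - 1; - 1 * w; w; w ^+ 2] != 0.
  apply: (neq0_of_mul 5 (e := - 1)) => //.
  by rewrite /syzygy_det /=; apply: (eq_modulo (- 5 + 4 * w + 3 * w ^+ 2 - w ^+ 3) wE); ring.
have /negPf -> : syzygy_det [:: 1; w ^+ 2; - 1; w; - 1 * w ^+ 2; - 1 * w] != 0.
  apply: (neq0_of_mul 5 (e := - 1)) => //.
  by rewrite /syzygy_det /=; apply: (eq_modulo (- 5 + 6 * w - w ^+ 2 + w ^+ 3) wE); ring.
have /negPf -> : syzygy_det [:: 1; w ^+ 2; - 1; - 1 * w ^+ 2; w; - 1 * w] != 0.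
  apply: (neq0_of_mul 4 (e := - 1)) => //.
  by rewrite /syzygy_det /=; apply: (eq_modulo (- 4 + 4 * w - 4 * w ^+ 2) wE); ring.
have /negPf -> : syzygy_det [:: 1; w ^+ 2; - 1; - 1 * w; w; - 1 * w ^+ 2] != 0.
  apply: (neq0_of_mul 5 (e := 1)) => //.
  by rewrite /syzygy_det /=; apply: (eq_modulo (- 5 + 6 * w - w ^+ 2 + w ^+ 3) wE); ring.
have -> : syzygy_det [:: 1; - 1 * w; - 1; w; - 1 * w ^+ 2; w ^+ 2] == 0.
  by apply/eqP; rewrite /syzygy_det /=; apply: (eq_modulo (- 2 * w + 4 * w ^+ 2 - 2 * w ^+ 3) wE);
      ring.
have /negPf -> : syzygy_det [:: 1; - 1 * w; - 1; - 1 * w ^+ 2; w; w ^+ 2] != 0.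
  apply: (neq0_of_mul 5 (e := - 1)) => //.
  by rewrite /syzygy_det /=; apply: (eq_modulo (- 5 + 6 * w - w ^+ 2 + w ^+ 3) wE); ring.
have /negPf -> : syzygy_det [:: 1; - 1 * w; - 1; w ^+ 2; w; - 1 * w ^+ 2] != 0.
  apply: (neq0_of_mul 9 (e := 1)) => //.
  by rewrite /syzygy_det /=; apply: (eq_modulo (- 9 + 8 * w - w ^+ 2 - w ^+ 3) wE); ring.
by [].
Qed.

Lemma uniq_octahedron {F : numFieldType} (i s : F) : i ^+ 2 + 1 = 0 -> s ^+ 2 - 2 = 0 -> uniq
    (octahedron i s).
Proof.
move=> iE sE.
have /negPf n01 : i != 1 + s :> F.
  rewrite -subr_eq0; apply: (neq0_of_mul 4 (e := - 2 * i + i * s - s)) => //.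
  by apply: (eq_modulo2 (- 2 + s) (1 - i) iE sE); ring.
have /negPf n02 : i != s - 1 :> F.
  rewrite -subr_eq0; apply: (neq0_of_mul 4 (e := - 2 * i - i * s - s)) => //.
  by apply: (eq_modulo2 (- 2 - s) (1 + i) iE sE); ring.
have /negPf n03 : i != - 1 - s :> F.
  rewrite -subr_eq0; apply: (neq0_of_mul 4 (e := - 2 * i + i * s + s)) => //.
  by apply: (eq_modulo2 (- 2 + s) (1 + i) iE sE); ring.
have /negPf n04 : i != 1 - s :> F.
  rewrite -subr_eq0; apply: (neq0_of_mul 4 (e := - 2 * i - i * s + s)) => //.
  by apply: (eq_modulo2 (- 2 - s) (1 - i) iE sE); ring.
have /negPf n05 : i != - i :> F.
  rewrite -subr_eq0; apply: (neq0_of_mul 2 (e := - i)) => //.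
  by apply: (eq_modulo2 (- 2) (0) iE sE); ring.
have /negPf n12 : 1 + s != s - 1 :> F.
  rewrite -subr_eq0; apply: (neq0_of_mul 2 (e := 1)) => //.
  by apply: (eq_modulo2 (0) (0) iE sE); ring.
have /negPf n13 : 1 + s != - 1 - s :> F.
  rewrite -subr_eq0; apply: (neq0_of_mul 2 (e := - 1 + s)) => //.
  by apply: (eq_modulo2 (0) (2) iE sE); ring.
have /negPf n14 : 1 + s != 1 - s :> F.
  rewrite -subr_eq0; apply: (neq0_of_mul 4 (e := s)) => //.
  by apply: (eq_modulo2 (0) (2) iE sE); ring.
have /negPf n15 : 1 + s != - i :> F.
  rewrite -subr_eq0; apply: (neq0_of_mul 4 (e := - 2 * i + i * s + s)) => //.
  by apply: (eq_modulo2 (- 2 + s) (1 + i) iE sE); ring.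
have /negPf n23 : s - 1 != - 1 - s :> F.
  rewrite -subr_eq0; apply: (neq0_of_mul 4 (e := s)) => //.
  by apply: (eq_modulo2 (0) (2) iE sE); ring.
have /negPf n24 : s - 1 != 1 - s :> F.
  rewrite -subr_eq0; apply: (neq0_of_mul 2 (e := 1 + s)) => //.
  by apply: (eq_modulo2 (0) (2) iE sE); ring.
have /negPf n25 : s - 1 != - i :> F.
  rewrite -subr_eq0; apply: (neq0_of_mul 4 (e := - 2 * i - i * s + s)) => //.
  by apply: (eq_modulo2 (- 2 - s) (1 - i) iE sE); ring.
have /negPf n34 : - 1 - s != 1 - s :> F.
  rewrite -subr_eq0; apply: (neq0_of_mul 2 (e := - 1)) => //.
  by apply: (eq_modulo2 (0) (0) iE sE); ring.
have /negPf n35 : - 1 - s != - i :> F.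
  rewrite -subr_eq0; apply: (neq0_of_mul 4 (e := - 2 * i + i * s - s)) => //.
  by apply: (eq_modulo2 (- 2 + s) (1 - i) iE sE); ring.
have /negPf n45 : 1 - s != - i :> F.
  rewrite -subr_eq0; apply: (neq0_of_mul 4 (e := - 2 * i - i * s - s)) => //.
  by apply: (eq_modulo2 (- 2 - s) (1 + i) iE sE); ring.
by rewrite /= !inE n01 n02 n03 n04 n05 n12 n13 n14 n15 n23 n24 n25 n34 n35 n45.
Qed.

Lemma uniq_hexagon {F : numFieldType} (w : F) : w ^+ 2 + w + 1 = 0 -> uniq (hexagon_roots w (- 1)).
Proof.
move=> wE.
have /negPf n01 : 1 != - 1 :> F.
  rewrite -subr_eq0; apply: (neq0_of_mul 2 (e := 1)) => //.
  by apply: (eq_modulo (0) wE); ring.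
have /negPf n02 : 1 != w :> F.
  rewrite -subr_eq0; apply: (neq0_of_mul 3 (e := 2 + w)) => //.
  by apply: (eq_modulo (- 1) wE); ring.
have /negPf n03 : 1 != - 1 * w ^+ 2 :> F.
  rewrite -subr_eq0; apply: (neq0_of_mul 1 (e := 1 + w)) => //.
  by apply: (eq_modulo (w) wE); ring.
have /negPf n04 : 1 != w ^+ 2 :> F.
  rewrite -subr_eq0; apply: (neq0_of_mul 3 (e := 1 - w)) => //.
  by apply: (eq_modulo (- 2 + w) wE); ring.
have /negPf n05 : 1 != - 1 * w :> F.
  rewrite -subr_eq0; apply: (neq0_of_mul 1 (e := - w)) => //.
  by apply: (eq_modulo (- 1) wE); ring.
have /negPf n12 : - 1 != w :> F.
  rewrite -subr_eq0; apply: (neq0_of_mul 1 (e := w)) => //.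
  by apply: (eq_modulo (- 1) wE); ring.
have /negPf n13 : - 1 != - 1 * w ^+ 2 :> F.
  rewrite -subr_eq0; apply: (neq0_of_mul 3 (e := - 1 + w)) => //.
  by apply: (eq_modulo (- 2 + w) wE); ring.
have /negPf n14 : - 1 != w ^+ 2 :> F.
  rewrite -subr_eq0; apply: (neq0_of_mul 1 (e := - 1 - w)) => //.
  by apply: (eq_modulo (w) wE); ring.
have /negPf n15 : - 1 != - 1 * w :> F.
  rewrite -subr_eq0; apply: (neq0_of_mul 3 (e := - 2 - w)) => //.
  by apply: (eq_modulo (- 1) wE); ring.
have /negPf n23 : w != - 1 * w ^+ 2 :> F.
  rewrite -subr_eq0; apply: (neq0_of_mul 1 (e := - 1)) => //.
  by apply: (eq_modulo (- 1) wE); ring.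
have /negPf n24 : w != w ^+ 2 :> F.
  rewrite -subr_eq0; apply: (neq0_of_mul 3 (e := - 1 - 2 * w)) => //.
  by apply: (eq_modulo (- 3 + 2 * w) wE); ring.
have /negPf n25 : w != - 1 * w :> F.
  rewrite -subr_eq0; apply: (neq0_of_mul 2 (e := - 1 - w)) => //.
  by apply: (eq_modulo (- 2) wE); ring.
have /negPf n34 : - 1 * w ^+ 2 != w ^+ 2 :> F.
  rewrite -subr_eq0; apply: (neq0_of_mul 2 (e := - w)) => //.
  by apply: (eq_modulo (- 2 + 2 * w) wE); ring.
have /negPf n35 : - 1 * w ^+ 2 != - 1 * w :> F.
  rewrite -subr_eq0; apply: (neq0_of_mul 3 (e := - 1 - 2 * w)) => //.
  by apply: (eq_modulo (- 3 + 2 * w) wE); ring.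
have /negPf n45 : w ^+ 2 != - 1 * w :> F.
  rewrite -subr_eq0; apply: (neq0_of_mul 1 (e := - 1)) => //.
  by apply: (eq_modulo (- 1) wE); ring.
by rewrite /= !inE n01 n02 n03 n04 n05 n12 n13 n14 n15 n23 n24 n25 n34 n35 n45.
Qed.

Lemma octahedron_det {F : comPzRingType} (i s : F) : i ^+ 2 + 1 = 0 -> s ^+ 2 - 2 = 0 -> syzygy_det
    (octahedron i s) = 0.
Proof. by move=> iE sE; rewrite /syzygy_det /=; apply: (eq_modulo2 (- 2 * s) (- 4 * i - 2 * s) iE
    sE); ring. Qed.

Lemma octahedron_rot {F : comPzRingType} (i s : F) : i ^+ 2 + 1 = 0 -> s ^+ 2 - 2 = 0 -> syzygy_det
    (rot 1 (octahedron i s)) = 0.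
Proof. by move=> iE sE; rewrite /syzygy_det /=; apply: (eq_modulo2 (4 * s) (4 * s) iE sE); ring.
    Qed.

Lemma octahedron_pat {F : comPzRingType} (i s : F) : i ^+ 2 + 1 = 0 -> s ^+ 2 - 2 = 0 -> syzygy_det
    [seq (octahedron i s)`_j | j <- nth [::] patterns 1] = 0.
Proof. by move=> iE sE; rewrite /syzygy_det /=; apply: (eq_modulo2 (- 2 * s) (- 4 * i - 2 * s) iE
    sE); ring. Qed.

(** * Polynomial identities relating the special sextics *)

Section SpecialForms.
Context {A : comPzRingType}.

(** In the coordinates x + i y and x - i y, the condition m^4 = - l^4 changes the difference of
    fourth powers in [Q2] into a sum, which is real in x and y; 2 l^5 m = 1 normalizes the leading
    coefficient. *)
Lemma Q2_octahedron_identity (i l m x y : A) : i ^+ 2 + 1 = 0 -> m ^+ 4 = - l ^+ 4 -> 2 * l ^+ 5 *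
    m = 1 ->
  (l * x + l * i * y) * (m * x - m * i * y) * ((l * x + l * i * y) ^+ 4 - (m * x - m * i * y) ^+ 4)
      =
  x ^+ 6 - 5 * (x ^+ 4 * y ^+ 2) - 5 * (x ^+ 2 * y ^+ 4) + y ^+ 6.
Proof.
move=> iE mE lmE; pose a := x + i * y; pose b := x - i * y.
have abE : a * b = x ^+ 2 + y ^+ 2 by apply: (eq_modulo (- y ^+ 2) iE); rewrite /a /b; ring.
have ab4 : a ^+ 4 + b ^+ 4 = 2 * (x ^+ 4 - 6 * (x ^+ 2 * y ^+ 2) + y ^+ 4).
  apply: (eq_modulo (12 * x ^+ 2 * y ^+ 2 + 2 * y ^+ 4 * (i ^+ 2 - 1)) iE); rewrite /a /b; ring.
transitivity (l * m * (a * b) * (l ^+ 4 * a ^+ 4 - m ^+ 4 * b ^+ 4)); first by rewrite /a /b; ring.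
rewrite mE; transitivity (l ^+ 5 * m * (a * b) * (a ^+ 4 + b ^+ 4)); first by ring.
rewrite abE ab4; transitivity (2 * l ^+ 5 * m * (x ^+ 2 + y ^+ 2) * (x ^+ 4 - 6 * (x ^+ 2 * y ^+ 2)
    + y ^+ 4)).
  by ring.
by rewrite lmE; ring.
Qed.

Lemma octahedron_identity (i s x y : A) : i ^+ 2 + 1 = 0 -> s ^+ 2 - 2 = 0 ->
  (x - i * y) * (x - (1 + s) * y) * ((x - (s - 1) * y) * (x - (- 1 - s) * y)) *
  ((x - (1 - s) * y) * (x - - i * y)) =
  x ^+ 6 - 5 * (x ^+ 4 * y ^+ 2) - 5 * (x ^+ 2 * y ^+ 4) + y ^+ 6.
Proof.
move=> iE sE.
have h1 : (x - i * y) * (x - - i * y) = x ^+ 2 + y ^+ 2 by apply: (eq_modulo (- y ^+ 2) iE); ring.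
have h2 : (x - (1 + s) * y) * (x - (1 - s) * y) = x ^+ 2 - 2 * (x * y) - y ^+ 2.
  by apply: (eq_modulo (- y ^+ 2) sE); ring.
have h3 : (x - (s - 1) * y) * (x - (- 1 - s) * y) = x ^+ 2 + 2 * (x * y) - y ^+ 2.
  by apply: (eq_modulo (- y ^+ 2) sE); ring.
transitivity ((x - i * y) * (x - - i * y) * ((x - (1 + s) * y) * (x - (1 - s) * y)) *
  ((x - (s - 1) * y) * (x - (- 1 - s) * y))).
  by move: (x - i * y) (x - - i * y) (x - (1 + s) * y) (x - (1 - s) * y) (x - (s - 1) * y) (x - (-
      1 - s) * y) =>
    a b c d e f; ring.
by rewrite h1 h2 h3; ring.
Qed.

(** The odd terms of (x + y)^6 + (x - y)^6 cancel, and the even binomial coefficients are 1, 15, 15,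
    1. *)
Lemma Q1_A15_identity (l x y : A) : 2 * l ^+ 6 = 1 ->
  (l * x + l * y) ^+ 6 + (l * x - l * y) ^+ 6 =
  x ^+ 6 + 15 * (x ^+ 4 * y ^+ 2) + 15 * (x ^+ 2 * y ^+ 4) + y ^+ 6.
Proof.
move=> lE; transitivity (2 * l ^+ 6 * (x ^+ 6 + 15 * (x ^+ 4 * y ^+ 2) + 15 * (x ^+ 2 * y ^+ 4) + y
    ^+ 6)).
  by ring.
by rewrite lE mul1r.
Qed.

End SpecialForms.

Lemma big_prod6 {T : Type} {A : pzRingType} (l : T -> A) (a b c d e f : T) :
  \prod_(i <- [:: a; b; c; d; e; f]) l i = l a * l b * (l c * l d) * (l e * l f).
Proof. by rewrite !big_cons big_nil mulr1 !mulrA. Qed.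

Lemma morph_diag_sextic {F : comNzRingType} {A : comAlgType F} {h : A -> A} {X6 X3 Y3 Y6 : A} {c d
    : F} :
  {morph h : p q / p + q} -> (forall a p, h (a *: p) = a *: h p) -> {morph h : p q / p * q} ->
  h X6 = X6 -> h X3 = X3 -> h Y3 = c *: Y3 -> h Y6 = d *: Y6 -> forall b e : F,
  h (X6 + b *: (X3 * Y3) + e *: Y6) = X6 + (b * c) *: (X3 * Y3) + (e * d) *: Y6.
Proof.
by move=> hD hZ hM h6 h3 k3 k6 b e; rewrite !(hD, hZ, hM) h6 h3 k3 k6 -scalerAr !scalerA.
Qed.

Lemma size_mul3_eq7 {F : idomainType} {a b c : {poly F}} :
  (size a <= 3)%N -> (size b <= 3)%N -> (size c <= 3)%N -> size (a * b * c) = 7%N ->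
  [/\ size a = 3%N, size b = 3%N & size c = 3%N].
Proof.
move=> la lb lc sz; have : a * b * c != 0 by rewrite -size_poly_eq0 sz.
rewrite !mulf_eq0 !negb_or => /andP[/andP[a0 b0] c0].
move: sz; rewrite size_mul ?mulf_neq0 // size_mul //.
by move: a0 b0 c0; rewrite -!size_poly_gt0 => a0 b0 c0 sz; split; lia.
Qed.

Set Implicit Arguments.
Unset Strict Implicit.
Unset Printing Implicit Defensive.

(** * Moebius maps and the normal form of a hexagon *)

Section Moebius.
Variables (F : fieldType) (u1 u0 v1 v0 : F).
Hypothesis det0 : u1 * v0 - u0 * v1 != 0.
Let U a := u1 * a + u0.
Let V a := v1 * a + v0.

Lemma moebius_eq0 a : U a = 0 -> V a = 0 -> False.
Proof.
move=> Ua Va; have /eqP := det0; apply.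
by rewrite [LHS](_ : _ = u1 * V a - v1 * U a); [rewrite Ua Va !mulr0 subrr|rewrite /U /V; ring].
Qed.

Lemma moebius_dependent a p q p' q' : p * U a + q * V a = 0 -> p' * U a + q' * V a = 0 ->
  p * q' - q * p' = 0.
Proof.
move=> e e'; have [Ua|Ua] := eqVneq (U a) 0; last first.
  apply: (mulIf Ua); rewrite mul0r [LHS](_ : _ = q' * (p * U a + q * V a) - q * (p' * U a + q' * V
      a)).
    by rewrite e e' !mulr0 subrr.
  by ring.
have Va : V a != 0 by apply/eqP => Va; apply: moebius_eq0 Ua Va.
apply: (mulIf Va); rewrite mul0r [LHS](_ : _ = p * (p' * U a + q' * V a) - p' * (p * U a + q * V
    a)).
  by rewrite e e' !mulr0 subrr.
by ring.
Qed.

(** Congruence of the symmetric matrix with rows (A, B) and (B, C) by the adjugate of the Moebius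
    matrix. It transports the involution, and the determinant is multiplied by a square. Homogeneous
    coordinates (U : V) allow the image to be infinity. *)
Lemma moebius_annihilator A B C : A * C - B ^+ 2 != 0 ->
  exists A' B' C', A' * C' - B' ^+ 2 != 0 /\ forall a b, A * (a * b) + B * (a + b) + C = 0 ->
    A' * (U a * U b) + B' * (U a * V b + U b * V a) + C' * (V a * V b) = 0.
Proof.
move=> AC; exists (A * v0 ^+ 2 - B * v0 * v1 - B * v0 * v1 + C * v1 ^+ 2).
exists (- A * u0 * v0 + B * (v0 * u1 + u0 * v1) - C * u1 * v1).
exists (A * u0 ^+ 2 - B * u0 * u1 - B * u0 * u1 + C * u1 ^+ 2); split.
  rewrite [X in X != 0](_ : _ = (u1 * v0 - u0 * v1) ^+ 2 * (A * C - B ^+ 2)); last by ring.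
  by rewrite mulf_neq0 // expf_neq0.
move=> a b h; rewrite [LHS](_ : _ = (u1 * v0 - u0 * v1) ^+ 2 * (A * (a * b) + B * (a + b) + C)).
  by rewrite h mulr0.
by rewrite /U /V; ring.
Qed.

Lemma moebius_syzygy_det (t z : seq F) : uniq t -> size t = 6%N -> syzygy_det t = 0 ->
  (forall i, (i < 6)%N -> U t`_i = z`_i * V t`_i) -> syzygy_det z = 0.
Proof.
move=> ut szt D0 h.
have V0 i : (i < 6)%N -> V t`_i != 0.
  by move=> i6; apply/eqP => Vi; apply: (@moebius_eq0 t`_i) => //; rewrite h // Vi mulr0.
case: t ut szt D0 h V0 => [|a [|b [|c [|d [|e [|f []]]]]]] // ut _ D0 h V0.
have [A [B [C [AC E0 E1 E2]]]] := syzygy_det_annihilator _ _ _ _ _ _ ut D0.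
have [A' [B' [C' [AC' ann]]]] := moebius_annihilator AC.
have key i j x y : U x = z`_i * V x -> U y = z`_j * V y -> V x != 0 -> V y != 0 ->
    A * (x * y) + B * (x + y) + C = 0 -> A' * (z`_i * z`_j) + B' * (z`_i + z`_j) + C' = 0.
  move=> ex ey vx vy /ann; rewrite ex ey => e0.
  by apply: (mulIf (mulf_neq0 vx vy)); rewrite mul0r -[RHS]e0; ring.
apply: (annihilator_syzygy_det _ A' B' C' AC').
- exact: (key _ _ _ _ (h 0%N isT) (h 1%N isT) (V0 0%N isT) (V0 1%N isT) E0).
- exact: (key _ _ _ _ (h 2%N isT) (h 3%N isT) (V0 2%N isT) (V0 3%N isT) E1).
- exact: (key _ _ _ _ (h 4%N isT) (h 5%N isT) (V0 4%N isT) (V0 5%N isT) E2).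
Qed.

End Moebius.

(** With s and s' the two involutions, the equations say s(z) = s'(w z) at z = 1, w, w^2, hence
    everywhere, so s' s is z |-> w z. The involution s conjugates this rotation to its inverse, thus
    exchanges the fixed points 0 and infinity, which is B = 0. *)
Lemma hexagon_equations {F : numFieldType} (w A B C A' B' C' : F) : w ^+ 2 + w + 1 = 0 -> w - 1 !=
    0 ->
  A * C - B ^+ 2 != 0 -> A' * C' - B' ^+ 2 != 0 ->
  (A + B) * (B' * w + C') - (B + C) * (A' * w + B') = 0 ->
  (A * w + B) * (B' * w ^+ 2 + C') - (B * w + C) * (A' * w ^+ 2 + B') = 0 ->
  (A * w ^+ 2 + B) * (B' + C') - (B * w ^+ 2 + C) * (A' + B') = 0 -> B = 0.
Proof.
move=> wE w1 AC AC' E0 E1 E2.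
have three : 3 != 0 :> F by rewrite pnatr_eq0.
have w3 : w ^+ 3 = 1 by apply: (eq_modulo (w - 1) wE); ring.
have wn0 : w != 0 by apply: contraTneq (oner_neq0 F) => w0; rewrite -w3 w0 expr0n eqxx.
(* Cross-multiplied form of s(z) = s'(w z): a quadratic in z vanishing at the cube roots of unity.
   The discrete Fourier sums [X0], [X2], [X1] extract its coefficients. *)
pose E z := (A * z + B) * (B' * w * z + C') - (B * z + C) * (A' * w * z + B').
have e0 : E 1 = 0 by rewrite -[RHS]E0 /E; ring.
have e1 : E w = 0 by rewrite -[RHS]E1 /E; ring.
have e2 : E (w ^+ 2) = 0 by rewrite /E -!(mulrA _ w) -exprS w3 !mulr1.
have X0 : B * C' - C * B' = 0.
  apply: (mulfI three); transitivity (E 1 + E w + E (w ^+ 2)); last by rewrite e0 e1 e2 !addr0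
      mulr0.
  rewrite /E.
  by apply: (eq_modulo (- A * B' * w + A * B' * w ^+ 2 - A * B' * w ^+ 3 - A * C' + A' * B * w - A'
      * B * w ^+ 2 + A' * B * w ^+ 3 + A' * C * w + B * B' - B * B' * w) wE); ring.
have X2 : A * B' - B * A' = 0.
  apply: (mulfI (mulf_neq0 three wn0)).
  transitivity (E 1 + w * E w + w ^+ 2 * E (w ^+ 2)); last by rewrite e0 e1 e2 !mulr0 !addr0.
  rewrite /E.
  by apply: (eq_modulo (2 * A * B' * w - 2 * A * B' * w ^+ 2 + A * B' * w ^+ 4 - A * B' * w ^+ 5 -
      A * C' + A * C' * w - A * C' * w ^+ 2 - 2 * A' * B * w + 2 * A' * B * w ^+ 2 - A' * B * w ^+
      4 + A' * B * w ^+ 5 + A' * C * w - A' * C * w ^+ 2 + A' * C * w ^+ 3 + B * B' - 2 * B * B' *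
      w + 2 * B * B' * w ^+ 2 - B * B' * w ^+ 3 - B * C' + B' * C) wE); ring.
have X1 : A * C' + w * B * B' - B * B' - w * C * A' = 0.
  apply: (mulfI three).
  transitivity (E 1 + w ^+ 2 * E w + w * E (w ^+ 2)); last by rewrite e0 e1 e2 !mulr0 !addr0.
  rewrite /E.
  by apply: (eq_modulo (- A * B' * w + A * B' * w ^+ 2 - A * B' * w ^+ 4 + 2 * A * C' - 2 * A * C'
      * w + A' * B * w - A' * B * w ^+ 2 + A' * B * w ^+ 4 - 2 * A' * C * w + 2 * A' * C * w ^+ 2 -
      2 * B * B' + 4 * B * B' * w - 2 * B * B' * w ^+ 2 - B * C' + B' * C) wE); ring.
(* If B were nonzero, the three coefficient equations would force A' = B' = C' = 0. *)
apply/eqP/negPn/negP => Bn0; have B'0 : B' = 0.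
  apply: (mulIf (mulf_neq0 w1 AC)); rewrite mul0r.
  rewrite [LHS](_ : _ = - B * (A * C' + w * B * B' - B * B' - w * C * A') + A * (B * C' - C * B') +
      w * C * (A * B' - B * A')); last by ring.
  by rewrite X0 X1 X2 !mulr0 !addr0.
have A'0 : A' = 0.
  by apply: (mulfI Bn0); rewrite mulr0 -[LHS](subKr (A * B')) X2 B'0 mulr0 subr0.
have C'0 : C' = 0 by apply: (mulfI Bn0); move: X0; rewrite B'0 mulr0 subr0 mulr0.
by move: AC'; rewrite A'0 B'0 mul0r expr0n subrr eqxx.
Qed.

Lemma hexagon_moebius {F : numFieldType} (w : F) (t : seq F) : w ^+ 2 + w + 1 = 0 -> w - 1 != 0 ->
  uniq t -> size t = 6%N -> syzygy_det t = 0 -> syzygy_det (rot 1 t) = 0 ->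
  exists u1 u0 v1 v0 k, [/\ u1 * v0 - u0 * v1 != 0, k != 0 & forall i, (i < 6)%N ->
    u1 * t`_i + u0 = (hexagon_roots w k)`_i * (v1 * t`_i + v0)].
Proof.
move=> wE w1 ut szt D D'.
have ut' : uniq (rot 1 t) by rewrite rot_uniq.
case: t ut szt D D' ut' => [|a0 [|a1 [|a2 [|a3 [|a4 [|a5 []]]]]]] // ut _ D D' ut'.
have [A [B [C [AC E0 E1 E2]]]] := syzygy_det_annihilator _ _ _ _ _ _ ut D.
have [A' [B' [C' [AC' E0' E1' E2']]]] := syzygy_det_annihilator _ _ _ _ _ _ ut' D'.
have w3 : w ^+ 3 = 1 by apply: (eq_modulo (w - 1) wE); ring.
have wn0 : w != 0 by apply: contraTneq (oner_neq0 F) => w0; rewrite -w3 w0 expr0n eqxx.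
have [a02 a04 a24] : [/\ a0 != a2, a0 != a4 & a2 != a4].
  by move: ut; rewrite /= !inE !negb_or -!andbA => /and5P[_ -> _ -> /and5P[_ _ _ _ /and5P[_ _ -> _
      _]]].
(* Chosen so that U - V = (1 - w) c0 (z - a0) and U - w V = (1 - w) c2 (z - a2), which sends a0 to 1
   and a2 to w; the ratio of c0 to c2 is then dictated by a4 going to w^2. *)
pose c0 := a2 - a4; pose c2 := w ^+ 2 * (a4 - a0).
pose v1 := c2 - c0; pose v0 := c0 * a0 - c2 * a2; pose u1 := c2 - w * c0; pose u0 := w * c0 * a0 -
    c2 * a2.
have det0 : u1 * v0 - u0 * v1 != 0.
  rewrite [X in X != 0](_ : _ = - (c0 * c2 * (w - 1) * (a0 - a2))); last by rewrite /u1 /v0 /u0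
      /v1; ring.
  by rewrite oppr_eq0 !mulf_neq0 // ?expf_neq0 // subr_eq0 // eq_sym.
pose U a := u1 * a + u0; pose V a := v1 * a + v0.
have U0 : U a0 = V a0 by rewrite /U /V /u1 /v0 /u0 /v1; ring.
have U2 : U a2 = w * V a2 by rewrite /U /V /u1 /v0 /u0 /v1; ring.
have U4 : U a4 = w ^+ 2 * V a4.
  by apply: (eq_modulo (a0 * a2 * w - a0 * a2 * w ^+ 2 - a0 * a4 * w + a0 * a4 * w ^+ 2 - a2 * a4 *
      w + a2 * a4 * w ^+ 2 + a4 ^+ 2 * w - a4 ^+ 2 * w ^+ 2) wE); rewrite /U /V /u1 /v0 /u0 /v1 /c0
      /c2; ring.
have nz a : U a = 0 -> V a = 0 -> False by exact: (moebius_eq0 det0).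
have V0 : V a0 != 0 by apply/eqP => h; apply: (nz a0); rewrite // U0.
have V2 : V a2 != 0 by apply/eqP => h; apply: (nz a2); rewrite // U2 h mulr0.
have V4 : V a4 != 0 by apply/eqP => h; apply: (nz a4); rewrite // U4 h mulr0.
have [P [Q [S [PS ann]]]] := moebius_annihilator det0 AC.
have [P' [Q' [S' [PS' ann']]]] := moebius_annihilator det0 AC'.
have step (p q r c b d : F) : U b = c * V b -> V b != 0 ->
    p * (U b * U d) + q * (U b * V d + U d * V b) + r * (V b * V d) = 0 ->
    (p * c + q) * U d + (q * c + r) * V d = 0.
  by move=> e vb h; apply: (mulfI vb); rewrite mulr0 -[RHS]h e; ring.
have stepr (p q r c b d : F) : U b = c * V b -> V b != 0 ->
    p * (U d * U b) + q * (U d * V b + U b * V d) + r * (V d * V b) = 0 ->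
    (p * c + q) * U d + (q * c + r) * V d = 0.
  by move=> e vb h; apply: (mulfI vb); rewrite mulr0 -[RHS]h e; ring.
have U0' : U a0 = 1 * V a0 by rewrite mul1r.
(* Each odd vertex satisfies one linear equation in (U : V) from each of the two involutions.
   Eliminating the vertex leaves the hypotheses of [hexagon_equations]. *)
have F0 := step _ _ _ _ _ _ U0' V0 (ann _ _ E0).
have F1 := step _ _ _ _ _ _ U2 V2 (ann _ _ E1).
have F2 := step _ _ _ _ _ _ U4 V4 (ann _ _ E2).
have F0' := stepr _ _ _ _ _ _ U2 V2 (ann' _ _ E0').
have F1' := stepr _ _ _ _ _ _ U4 V4 (ann' _ _ E1').
have F2' := stepr _ _ _ _ _ _ U0' V0 (ann' _ _ E2').
rewrite !mulr1 in F0 F2'.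
have Q0 : Q = 0.
  apply: (hexagon_equations wE w1 PS PS').
  - exact: (moebius_dependent det0 F0 F0').
  - exact: (moebius_dependent det0 F1 F1').
  - exact: (moebius_dependent det0 F2 F2').
move: PS F0 F1 F2; rewrite Q0 expr0n subr0 mulf_eq0 negb_or !addr0 !mul0r !add0r => /andP[P0 S0] F0
    F1 F2.
(* With Q = 0 the first involution is z |-> - (S / P) / z, so k is - S / P and the odd vertices are
   k divided by 1, w and w^2. *)
have solve c d : P * c * U d + S * V d = 0 -> c != 0 -> U d = - S / P * c^-1 * V d.
  move=> h cn0; apply: (mulfI (mulf_neq0 P0 cn0)).
  apply/eqP; rewrite -subr_eq0; apply/eqP; rewrite -[RHS]h.
  by field; apply/andP.
exists u1, u0, v1, v0, (- S / P); split=> //.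
  by rewrite mulf_neq0 ?oppr_eq0 ?invr_eq0.
have wV : w^-1 = w ^+ 2 by apply: (mulfI wn0); rewrite divff // -exprS w3.
have w2V : (w ^+ 2)^-1 = w by apply: invr_inj; rewrite invrK wV.
case=> [|[|[|[|[|[|//]]]]]] _ /=; rewrite -?/(U _) -?/(V _).
- exact: U0'.
- by rewrite -[- S / P]mulr1 -invr1; apply: solve; rewrite ?oner_neq0 // mulr1.
- exact: U2.
- by rewrite -wV; exact: solve.
- exact: U4.
- by rewrite -[X in _ * X * _]w2V; apply: solve => //; rewrite expf_neq0.
Qed.

(** Since k and 1 + 2 w are nonzero, this pattern leaves only k = -1. *)
Lemma hexagon_roots_det0 {F : comPzRingType} (w k : F) : w ^+ 2 + w + 1 = 0 ->
  syzygy_det [seq (hexagon_roots w k)`_i | i <- [:: 0; 1; 2; 5; 4; 3]%N] = - 3 * k * (1 + k) * (1 +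
      2 * w).
Proof.
move=> wE; rewrite /syzygy_det /=.
by apply: (eq_modulo (3 * k + 2 * k * w - 3 * k * w ^+ 2 + k * w ^+ 3 + 3 * k ^+ 2 + 2 * k ^+ 2 * w
    - 3 * k ^+ 2 * w ^+ 2 + k ^+ 2 * w ^+ 3) wE); ring.
Qed.

(** The same cubic as for the last pattern, with k w in place of k; the normal form depends on k^3
    only, so both patterns lead to the same sextic. The linear factor vanishes only when two
    vertices collide. *)
Lemma hexagon_roots_det1 {F : comPzRingType} (w k : F) : w ^+ 2 + w + 1 = 0 ->
  syzygy_det [seq (hexagon_roots w k)`_i | i <- [:: 0; 2; 4; 1; 3; 5]%N] = (k * w - 1) * ((k * w)
      ^+ 2 + 4 * (k * w) + 1).
Proof.
move=> wE; rewrite /syzygy_det /=.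
by apply: (eq_modulo (1 + 2 * k * w - 3 * k ^+ 2 * w ^+ 2 + k ^+ 2 * w ^+ 3 - w) wE); ring.
Qed.

Lemma hexagon_roots_det2 {F : comPzRingType} (w k : F) : w ^+ 2 + w + 1 = 0 ->
  syzygy_det [seq (hexagon_roots w k)`_i | i <- [:: 0; 2; 4; 3; 1; 5]%N] = (k - 1) * (k ^+ 2 + 4 *
      k + 1).
Proof.
move=> wE; rewrite /syzygy_det /=.
by apply: (eq_modulo (1 + 3 * k - 2 * k * w + k * w ^+ 3 - 3 * k ^+ 2 + 2 * k ^+ 2 * w - k ^+ 2 * w
    ^+ 3 - k ^+ 3 + k ^+ 3 * w - w) wE); ring.
Qed.

(** * Binary forms and their roots *)

Section BinaryForms.
Variable R : realType.
Local Notation C := R[i].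
Local Notation x := (varx R).
Local Notation y := (vary R).
Implicit Types (p q f g : {mpoly C[2]}) (a b c d : C).

Definition lin a := x - a *: y.

(** Substitution of 1 for y. On forms of a fixed degree nothing is lost, and a root at (1 : 0) shows
    as a drop of the size. *)
Definition dehom p : {poly C} :=
  mmap (@polyC C) (fun i : 'I_2 => if i == ord0 then 'X else 1) p.

HB.instance Definition _ := GRing.RMorphism.copy dehom
  (mmap (@polyC C) (fun i : 'I_2 => if i == ord0 then 'X else 1)).

Lemma dehomx : dehom x = 'X.
Proof. by rewrite /dehom mmapX mmap1U. Qed.

Lemma dehomy : dehom y = 1.
Proof. by rewrite /dehom mmapX mmap1U. Qed.

Lemma dehomZ c p : dehom (c *: p) = c *: dehom p.
Proof. by rewrite /dehom mmapZ mul_polyC. Qed.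

Lemma dehom_lin a : dehom (lin a) = 'X - a%:P.
Proof. by rewrite /lin rmorphB /= dehomZ dehomx dehomy alg_polyC. Qed.

Lemma mpolyX2 (m : 'X_{1..2}) : 'X_[m] = x ^+ m ord0 * y ^+ m ord_max.
Proof. by rewrite mpolyXE_id big_ord_recl big_ord1; congr (_ * 'X_ _ ^+ m _); apply: val_inj. Qed.

Lemma homog_sumE n p : p \is n.-homog ->
  p = \sum_(i < n.+1) (dehom p)`_i *: (x ^+ i * y ^+ (n - i)).
Proof.
pose hom (u : {poly C}) := \sum_(i < n.+1) u`_i *: (x ^+ i * y ^+ (n - i)).
move=> /dhomogP hp; rewrite -/(hom _).
have homD : {morph hom : u v / u + v}.
  by move=> u v; rewrite /hom -big_split; apply: eq_bigr => i _; rewrite coefD scalerDl.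
have hom0 : hom 0 = 0.
  by apply: big1 => i _; rewrite coef0 scale0r.
have homZ c u : hom (c *: u) = c *: hom u.
  by rewrite /hom scaler_sumr; apply: eq_bigr => i _; rewrite coefZ scalerA.
rewrite {2}(mpolyE p) rmorph_sum /= (big_morph hom homD hom0) [LHS]mpolyE.
apply: eq_big_seq => m /hp mn; rewrite dehomZ homZ; congr (_ *: _).
have mE : (m ord0 + m ord_max = n)%N.
  by rewrite -mn [RHS]mdegE big_ord_recl big_ord1; congr (_ + m _)%N; apply: val_inj.
rewrite mpolyX2 rmorphM /= !rmorphXn /= dehomx dehomy expr1n mulr1 /hom.
have lt_m : (m ord0 < n.+1)%N by rewrite ltnS -mE leq_addr.
rewrite (bigD1 (Ordinal lt_m)) //= big1 => [|i /eqP ne].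
  by rewrite coefXn eqxx scale1r addr0 -[in RHS]mE addKn.
rewrite coefXn; case: eqP => [e|_]; last by rewrite scale0r.
by case: ne; apply: val_inj.
Qed.

Lemma dehom_inj n : {in n.-homog &, injective dehom}.
Proof. by move=> p q /homog_sumE pE /homog_sumE qE e; rewrite pE qE e. Qed.

Lemma size_dehom n p : p \is n.-homog -> (size (dehom p) <= n.+1)%N.
Proof.
move/homog_sumE => {1}->; rewrite rmorph_sum /=; apply: leq_trans (size_sum _ _ _) _.
apply/bigmax_leqP => i _; rewrite dehomZ rmorphM /= !rmorphXn /= dehomx dehomy expr1n mulr1.
by apply: leq_trans (size_scale_leq _ _) _; rewrite size_polyXn.
Qed.

Lemma homog_x : x \is 1.-homog.
Proof. by rewrite dhomogX; apply/eqP; exact: mdeg1. Qed.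

Lemma homog_y : y \is 1.-homog.
Proof. by rewrite dhomogX; apply/eqP; exact: mdeg1. Qed.

Lemma homog_comb a b : a *: x + b *: y \is 1.-homog.
Proof. by rewrite rpredD // dhomogZ // ?homog_x ?homog_y. Qed.

Lemma homog_lin a : lin a \is 1.-homog.
Proof. by rewrite rpredB // ?dhomogZ ?homog_x ?homog_y. Qed.

Lemma homog_prod_lin (r : seq C) : \prod_(a <- r) lin a \is (size r).-homog.
Proof.
elim: r => [|a r IH]; first by rewrite big_nil dhomog1.
by rewrite big_cons -[size _]add1n dhomogM ?homog_lin.
Qed.

Lemma dehom_prod_lin (r : seq C) :
  dehom (\prod_(a <- r) lin a) = \prod_(a <- r) ('X - a%:P).
Proof. by rewrite rmorph_prod /=; apply: eq_bigr => a _; rewrite -dehom_lin. Qed.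

(** Full size of [dehom p] means that (1 : 0) is not a root, so every root has the form (a : 1). *)
Lemma homog_split n p : p \is n.-homog -> size (dehom p) = n.+1 ->
  exists c, exists r, [/\ c != 0, size r = n & p = c *: \prod_(a <- r) lin a].
Proof.
move=> hp sz; have [r pE] := closed_field_poly_normal (dehom p).
have c0 : lead_coef (dehom p) != 0 by rewrite lead_coef_eq0 -size_poly_eq0 sz.
have szr : size r = n.
  by apply: succn_inj; rewrite -sz pE size_scale // size_prod_XsubC.
exists (lead_coef (dehom p)), r; split=> //; apply: (dehom_inj (n := n)) => //.
  by rewrite dhomogZ // -szr homog_prod_lin.
by rewrite dehomZ dehom_prod_lin.
Qed.

End BinaryForms.

(** * Linear changes of variables *)

Section Substitution.
Variable R : realType.
Local Notation C := R[i].
Local Notation x := (varx R).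
Local Notation y := (vary R).
Implicit Types (p q f g : {mpoly C[2]}) (a b c d : C).

Definition subst a b c d p := p \mPo [tuple a *: x + b *: y; c *: x + d *: y].

HB.instance Definition _ a b c d := GRing.RMorphism.copy (subst a b c d)
  (comp_mpoly [tuple a *: x + b *: y; c *: x + d *: y]).

Lemma substZ a b c d e p : subst a b c d (e *: p) = e *: subst a b c d p.
Proof. exact: comp_mpolyZ. Qed.

Lemma substx a b c d : subst a b c d x = a *: x + b *: y.
Proof. by rewrite /subst comp_mpolyXU. Qed.

Lemma substy a b c d : subst a b c d y = c *: x + d *: y.
Proof. by rewrite /subst comp_mpolyXU. Qed.

Lemma substD a b c d p q : subst a b c d (p + q) = subst a b c d p + subst a b c d q.
Proof. exact: rmorphD. Qed.
Lemma substB a b c d p q : subst a b c d (p - q) = subst a b c d p - subst a b c d q.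
Proof. exact: rmorphB. Qed.
Lemma substM a b c d p q : subst a b c d (p * q) = subst a b c d p * subst a b c d q.
Proof. exact: rmorphM. Qed.
Lemma substXn a b c d p n : subst a b c d (p ^+ n) = subst a b c d p ^+ n.
Proof. exact: rmorphXn. Qed.

Lemma substE a b c d p : subst a b c d p =
  \sum_(m <- msupp p) p@_m *: ((a *: x + b *: y) ^+ m ord0 * (c *: x + d *: y) ^+ m ord_max).
Proof.
rewrite {1}(mpolyE p) rmorph_sum; apply: eq_bigr => m _ /=.
by rewrite substZ mpolyX2 rmorphM !rmorphXn /= substx substy.
Qed.

Lemma subst_comp a b c d a' b' c' d' p :
  subst a' b' c' d' (subst a b c d p) =
  subst (a * a' + b * c') (a * b' + b * d') (c * a' + d * c') (c * b' + d * d') p.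
Proof.
have combE (e f : C) : subst a' b' c' d' (e *: x + f *: y) =
    (e * a' + f * c') *: x + (e * b' + f * d') *: y.
  by rewrite rmorphD /= !substZ substx substy -!mul_mpolyC; ring.
rewrite [subst a b c d p]substE [RHS]substE rmorph_sum; apply: eq_bigr => m _ /=.
by rewrite substZ rmorphM !rmorphXn /= !combE.
Qed.

Lemma subst_id p : subst 1 0 0 1 p = p.
Proof.
rewrite substE [RHS]mpolyE; apply: eq_bigr => m _.
by rewrite !scale1r !scale0r addr0 add0r mpolyX2.
Qed.

Lemma substK a b c d : a * d - b * c != 0 ->
  cancel (subst a b c d) (subst (d / (a * d - b * c)) (- b / (a * d - b * c))
                                (- c / (a * d - b * c)) (a / (a * d - b * c))).
Proof.
move=> D0 p; rewrite subst_comp -[RHS]subst_id.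
have -> : a * (d / (a * d - b * c)) + b * (- c / (a * d - b * c)) = 1 by field.
have -> : a * (- b / (a * d - b * c)) + b * (a / (a * d - b * c)) = 0 by field.
have -> : c * (d / (a * d - b * c)) + d * (- c / (a * d - b * c)) = 0 by field.
by have -> : c * (- b / (a * d - b * c)) + d * (a / (a * d - b * c)) = 1 by field.
Qed.

Lemma subst_inj a b c d : a * d - b * c != 0 -> injective (subst a b c d).
Proof. by move/substK/can_inj. Qed.

Lemma homog_subst n a b c d p : p \is n.-homog -> subst a b c d p \is n.-homog.
Proof.
move/homog_sumE => ->; rewrite rmorph_sum rpred_sum // => i _ /=.
rewrite substZ dhomogZ // rmorphM /= !rmorphXn /= substx substy.
have hX k (u : {mpoly C[2]}) : u \is 1.-homog -> u ^+ k \is k.-homog.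
  by move/dhomogMn => /(_ k); rewrite mul1n.
have := dhomogM (hX i _ (homog_comb a b)) (hX (n - i)%N _ (homog_comb c d)).
by rewrite subnKC // -ltnS.
Qed.

Lemma similar_subst a b c d p : a * d - b * c != 0 -> similar_form p (subst a b c d p).
Proof. by exists a, b, c, d. Qed.

Lemma similar_refl p : similar_form p p.
Proof. by rewrite -[X in similar_form _ X]subst_id; apply: similar_subst; rewrite mulr1 mulr0 subr0
    oner_neq0. Qed.

Lemma similar_trans q p p' : similar_form p q -> similar_form q p' -> similar_form p p'.
Proof.
case=> [a [b [c [d [D0 ->]]]]] [a' [b' [c' [d' [D0' ->]]]]].
rewrite -/(subst _ _ _ _ p) -/(subst _ _ _ _ _) subst_comp; apply: similar_subst.
by have := mulf_neq0 D0 D0'; congr (_ != 0); ring.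
Qed.

Lemma similar_sym p q : similar_form p q -> similar_form q p.
Proof.
case=> [a [b [c [d [D0 ->]]]]]; rewrite -/(subst _ _ _ _ p).
rewrite -[X in similar_form _ X](substK D0); apply: similar_subst.
rewrite [X in X != 0](_ : _ = (a * d - b * c)^-1) ?invr_neq0 //.
by field.
Qed.

(** The scalar substitution by an n-th root of c multiplies a form of degree n by c. *)
Lemma similar_scale n c p : c != 0 -> (0 < n)%N -> p \is n.-homog -> similar_form p (c *: p).
Proof.
move=> c0 n0 /homog_sumE pE; have eK := rootCK n0 c; set e := n.-root c in eK.
have -> : c *: p = subst e 0 0 e p.
  rewrite pE scaler_sumr rmorph_sum; apply: eq_bigr => i _ /=.
  rewrite substZ rmorphM /= !rmorphXn /= substx substy !scale0r addr0 add0r !exprZn.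
  rewrite -scalerAl -scalerAr !scalerA -mulrA -exprD subnKC -1?ltnS // eK; congr (_ *: _); ring.
apply: similar_subst; rewrite mul0r subr0 mulf_neq0 //;
  by apply: contra_neq c0 => e0; rewrite -eK e0 expr0n eqn0Ngt n0.
Qed.

Lemma proportional_subst a b c d f g : a * d - b * c != 0 ->
  proportional (subst a b c d f) (subst a b c d g) -> proportional f g.
Proof.
move=> D0 [s [t [st0]]]; rewrite -!substZ => /(subst_inj D0) e.
by exists s, t.
Qed.

Lemma reps_similar_le p q : similar_form p q -> reps p #<= reps q.
Proof.
case=> [a [b [c [d [D0 ->]]]]]; rewrite -/(subst a b c d p).
have inj := subst_inj D0.
have imE s t : subst a b c d @` [set s; t] = [set subst a b c d s; subst a b c d t].
  by rewrite image_setU !image_set1.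
rewrite -(card_le_eql (inj_card_eq (f := fun s : set {mpoly C[2]} => subst a b c d @` s) _)); last
    first.
  move=> s t _ _ st; apply: funext => u.
  by rewrite -(image_inj inj) st (image_inj inj).
apply: subset_card_le => _ [s [f [g [hf hg nprop -> ->]]] <-].
exists (subst a b c d f), (subst a b c d g); split; rewrite ?homog_subst //.
- by move/(proportional_subst D0).
- by rewrite rmorphD /= !rmorphXn.
- by rewrite imE !rmorphXn.
Qed.

Lemma reps_similar p q : similar_form p q -> reps p #= reps q.
Proof.
move=> pq; apply/card_eqPle; split; first exact: (reps_similar_le pq).
exact: (reps_similar_le (similar_sym pq)).
Qed.

End Substitution.

(** * Sums of two cubes and their three factors *)

Section Representations.
Variable R : realType.
Local Notation C := R[i].
Local Notation x := (varx R).
Local Notation y := (vary R).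
Implicit Types (p q f g : {mpoly C[2]}) (a b c d : C) (t : seq C) (s : set {mpoly C[2]}).

Lemma cube_root_of_unity_subproof : {w : C | w ^+ 2 + w + 1 = 0}.
Proof.
exists ((sqrtC (- 3) - 1) / 2); have : sqrtC (- 3) ^+ 2 + 3 = 0 :> C by rewrite sqrtCK addNr.
by move: (sqrtC _) => s sE; apply: (eq_modulo (1 / 4) sE); field.
Qed.

Definition omega : C := sval cube_root_of_unity_subproof.
Local Notation w := omega.

Lemma omegaP : w ^+ 2 + w + 1 = 0.
Proof. exact: svalP cube_root_of_unity_subproof. Qed.

Lemma omega_neq0 : w != 0.
Proof. by apply/eqP => w0; have /eqP := omegaP; rewrite w0 expr0n !add0r oner_eq0. Qed.

Lemma omega_neq1 : w - 1 != 0.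
Proof.
apply/eqP => /eqP; rewrite subr_eq0 => /eqP w1; have /eqP := omegaP.
by rewrite w1 (_ : 1 ^+ 2 + 1 + 1 = 3%:R) ?pnatr_eq0 //; ring.
Qed.

Lemma omega3 : w ^+ 3 = 1.
Proof. by apply: (eq_modulo (w - 1) omegaP); ring. Qed.

Definition ev z p : C := (dehom p).[z].

Lemma evD z p q : ev z (p + q) = ev z p + ev z q.
Proof. by rewrite /ev rmorphD hornerD. Qed.
Lemma evM z p q : ev z (p * q) = ev z p * ev z q.
Proof. by rewrite /ev rmorphM hornerM. Qed.
Lemma evZ z c p : ev z (c *: p) = c * ev z p.
Proof. by rewrite /ev dehomZ hornerZ. Qed.
Lemma ev_lin z a : ev z (lin a) = z - a.
Proof. by rewrite /ev dehom_lin hornerXsubC. Qed.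
Lemma ev0 z : ev z 0 = 0.
Proof. by rewrite /ev rmorph0 horner0. Qed.
Lemma evX z n p : ev z (p ^+ n) = ev z p ^+ n.
Proof. by rewrite /ev rmorphXn horner_exp. Qed.
Definition evE := (evD, evM, evZ, ev_lin, ev0, evX).

Lemma lin_neq0 a : lin a != 0.
Proof.
apply/eqP => /(congr1 (ev (a + 1))) /eqP.
by rewrite ev_lin ev0 addrAC subrr add0r oner_eq0.
Qed.

Lemma nproportional_eq0 f g a b :
  ~ proportional f g -> a *: f + b *: g = 0 -> a = 0 /\ b = 0.
Proof.
move=> nfg e; have [/eqP|ne] := eqVneq (a, b) (0, 0); first by rewrite xpair_eqE => /andP[/eqP->
    /eqP->].
case: nfg; exists a, (- b); split.
  by apply: contra ne; rewrite !xpair_eqE oppr_eq0.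
by apply/eqP; rewrite scaleNr -subr_eq0 opprK e.
Qed.

Lemma nproportional_neq0 f g a b :
  ~ proportional f g -> (a, b) != (0, 0) -> a *: f + b *: g != 0.
Proof. by move=> nfg; apply: contra_neq => /(nproportional_eq0 nfg)[-> ->]. Qed.

Lemma mpolyC_omega : (w%:MP : {mpoly C[2]}) ^+ 2 + w%:MP + 1 = 0.
Proof. by rewrite -rmorphXn -rmorphD -mpolyC1 -mpolyCD omegaP mpolyC0. Qed.

Lemma sum_cubesE f g : f ^+ 3 + g ^+ 3 = (f + g) * (f + w *: g) * (f + w ^+ 2 *: g).
Proof.
rewrite -!mul_mpolyC rmorphXn /=; move: (w%:MP) mpolyC_omega => W e.
by apply: (eq_modulo (- (f ^+ 2 * g + W * f * g ^+ 2 + (W - 1) * g ^+ 3)) e); ring.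
Qed.

Lemma sum_cubes_neq0 f g : ~ proportional f g -> f ^+ 3 + g ^+ 3 != 0.
Proof.
move=> nfg; have h c : f + c *: g != 0.
  rewrite -{1}[f]scale1r; apply: nproportional_neq0 => //.
  by rewrite xpair_eqE oner_eq0.
by have h1 := h 1; rewrite scale1r in h1; rewrite sum_cubesE (mulf_neq0 (mulf_neq0 h1 (h w)) (h (w
    ^+ 2))).
Qed.

(** The three factors span a plane and satisfy a single relation up to scaling, so proportional
    triples have one common ratio k0. Then f' = k0 f and g' = k0 g, and the equal sums of cubes give
    k0^3 = 1. *)
Lemma cubes_eq f g f' g' k0 k1 k2 : ~ proportional f g ->
  f ^+ 3 + g ^+ 3 = f' ^+ 3 + g' ^+ 3 ->
  f' + g' = k0 *: (f + g) -> f' + w *: g' = k1 *: (f + w *: g) ->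
  f' + w ^+ 2 *: g' = k2 *: (f + w ^+ 2 *: g) ->
  [set f ^+ 3; g ^+ 3] = [set f' ^+ 3; g' ^+ 3].
Proof.
move=> nfg pE e0 e1 e2.
(* The relation sum of w^j (f' + w^j g') = 0, rewritten through f and g; both coefficients vanish
   since f and g are not proportional. *)
have [h1 h2] : k0 + w * k1 + w ^+ 2 * k2 = 0 /\ k0 + w ^+ 2 * k1 + w * k2 = 0.
  apply: (nproportional_eq0 nfg).
  have e : k0 *: (f + g) + w *: (k1 *: (f + w *: g)) + w ^+ 2 *: (k2 *: (f + w ^+ 2 *: g)) = 0.
    rewrite -e0 -e1 -e2 -!mul_mpolyC rmorphXn /=; move: (w%:MP) mpolyC_omega => W WE.
    by apply: (eq_modulo (f' + g' + (W ^+ 2 - W) * g') WE); ring.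
  rewrite -[RHS]e -!mul_mpolyC !(rmorphD, rmorphM, rmorphXn) /=.
  move: (w%:MP) (k0%:MP) (k1%:MP) (k2%:MP) mpolyC_omega => W K0 K1 K2 WE.
  by apply: (eq_modulo (K2 * g * (W - W ^+ 2)) WE); ring.
have k12 : k1 = k2.
  apply/eqP; rewrite -subr_eq0; apply/eqP/(mulfI (mulf_neq0 omega_neq0 omega_neq1)).
  rewrite mulr0; have := congr2 (fun u v => u - v) h2 h1; rewrite subrr => <-.
  by move: w => W; ring.
have k01 : k0 = k1.
  rewrite -k12 in h1; move: w omegaP h1 => W WE h1.
  by apply: (eq_modulo (- k1) WE); rewrite -[LHS]subr0 -{}h1; ring.
rewrite -k12 -k01 in e2; rewrite -k01 in e1; clear k12 h1 h2 k01.
have gE : g' = k0 *: g.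
  apply: (scalerI omega_neq1).
  have -> : (w - 1) *: g' = f' + w *: g' - (f' + g').
    by rewrite scalerBl scale1r opprD addrACA subrr add0r.
  rewrite e1 e0 -scalerBr opprD addrACA subrr add0r scalerA [_ * k0]mulrC -scalerA.
  by rewrite scalerBl scale1r.
have fE : f' = k0 *: f by apply: (addIr g'); rewrite e0 gE scalerDr.
have k3 : k0 ^+ 3 = 1.
  have /eqP : (k0 ^+ 3 - 1) *: (f ^+ 3 + g ^+ 3) = 0.
    by rewrite scalerBl scale1r {2}pE fE gE !exprZn scalerDr subrr.
  by rewrite scaler_eq0 (negPf (sum_cubes_neq0 nfg)) orbF subr_eq0 => /eqP.
by rewrite fE gE !exprZn k3 !scale1r.
Qed.

End Representations.

Lemma dependent_sum (F : fieldType) (V : lmodType F) (X Y Z : V) (e0 e1 e2 s0 s1 s2 p0 p1 p2 : F) :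
  e0 + e1 + e2 = 0 -> e0 * s0 + e1 * s1 + e2 * s2 = 0 -> e0 * p0 + e1 * p1 + e2 * p2 = 0 ->
  e0 *: (X + s0 *: Y + p0 *: Z) + e1 *: (X + s1 *: Y + p1 *: Z) + e2 *: (X + s2 *: Y + p2 *: Z) = 0.
Proof.
move=> E S P; rewrite !scalerDr !scalerA.
have tri (a b c a' b' c' : V) : a + b + c + (a' + b' + c') = a + a' + (b + b') + (c + c').
  by rewrite addrACA (addrACA a).
by rewrite [X in X + _]tri tri -!scalerDl E S P !scale0r !addr0.
Qed.

Lemma scaler_mul3 (F : comNzRingType) (A : comAlgType F) (c0 c1 c2 : F) (X Y Z : A) :
  (c0 *: X) * (c1 *: Y) * (c2 *: Z) = (c0 * c1 * c2) *: (X * Y * Z).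
Proof. by rewrite -!scalerAr -!scalerAl !scalerA; congr (_ *: _); ring. Qed.

(* Used to name terms opaquely: a local definition would be unfolded during unification. *)
Lemma ex_eq (T : Type) (a : T) : exists b, b = a.
Proof. by exists a. Qed.

(** * The pencil spanned by the two quadratics *)

Section CubePencil.
Variables (F : fieldType) (V : lmodType F) (w : F).
Hypothesis w3 : w ^+ 3 = 1.

Lemma scaler_ratio (c c' : F) (u v q : V) :
  c != 0 -> u = c *: q -> v = c' *: q -> v = (c' / c) *: u.
Proof. by move=> c0 -> ->; rewrite scalerA divfK. Qed.

(** Passing from (f, g) to (w g, f) transposes the first two factors and keeps the cubes. *)
Lemma pencil_swap01 (f g q0 q1 q2 : V) (c0 c1 c2 : F) :
  f + g = c0 *: q0 -> f + w *: g = c1 *: q1 -> f + w ^+ 2 *: g = c2 *: q2 ->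
  [/\ w *: g + f = c1 *: q1, w *: g + w *: f = (w * c0) *: q0 &
      w *: g + w ^+ 2 *: f = (w ^+ 2 * c2) *: q2].
Proof.
move=> e0 e1 e2; split; first by rewrite addrC.
  by rewrite -scalerDr addrC e0 scalerA.
rewrite -scalerA -e2 scalerDr scalerA -exprD addrC; congr (_ + _ *: _).
by rewrite (exprD w 3 1) w3 mul1r expr1.
Qed.

Lemma pencil_swap12 (f g q0 q1 q2 : V) (c0 c1 c2 : F) :
  f + g = c0 *: q0 -> f + w *: g = c1 *: q1 -> f + w ^+ 2 *: g = c2 *: q2 ->
  [/\ g + f = c0 *: q0, g + w *: f = (w * c2) *: q2 & g + w ^+ 2 *: f = (w ^+ 2 * c1) *: q1].
Proof.
move=> e0 e1 e2; split; first by rewrite addrC.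
  by rewrite -scalerA -e2 scalerDr scalerA -exprS w3 scale1r addrC.
by rewrite -scalerA -e1 scalerDr scalerA -exprSr w3 scale1r addrC.
Qed.

Lemma pencil_relation (u v q0 q1 q2 c0 c1 c2 : F) : w ^+ 2 + w + 1 = 0 ->
  c0 * q0 = u + v -> c1 * q1 = u + w * v -> c2 * q2 = u + w ^+ 2 * v ->
  c0 * q0 + w * c1 * q1 + w ^+ 2 * c2 * q2 = 0.
Proof.
move=> wE e0 e1 e2; rewrite -!mulrA e0 e1 e2.
by apply: (eq_modulo (u + v * (w ^+ 2 - w + 1)) wE); ring.
Qed.

Hypotheses (wE : w ^+ 2 + w + 1 = 0) (w1 : w - 1 != 0).

(** Inverts the discrete Fourier transform: two factors determine f and g, and the relation gives
    the third. The explicit shape of f and g is kept so that their homogeneity can be read off. *)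
Lemma pencil_of_relation (q0 q1 q2 : V) : q0 + w *: q1 + w ^+ 2 *: q2 = 0 ->
  exists f g k, [/\ g = k *: (q0 - q1) & f = q0 - g] /\
    [/\ f + g = q0, f + w *: g = q1 & f + w ^+ 2 *: g = q2].
Proof.
move=> e; pose g := (1 - w)^-1 *: (q0 - q1); pose f := q0 - g.
exists f, g, (1 - w)^-1; split=> //.
 have w1' : 1 - w != 0 by rewrite -opprB oppr_eq0.
have fg : f + g = q0 by rewrite subrK.
have fwg : f + w *: g = q1.
  have -> : f + w *: g = f + g - (1 - w) *: g by rewrite scalerBl scale1r opprB addrA addrAC addrK.
  by rewrite fg scalerA divff // scale1r subKr.
clearbody f g; split=> //; have ww2 : w ^+ 2 * w = 1 by apply: (eq_modulo (w - 1) wE); ring.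
have w2n0 : w ^+ 2 != 0 by apply: contraTneq (oner_neq0 F) => w0; rewrite -ww2 w0 mul0r eqxx.
have -> : f + w ^+ 2 *: g = (1 + w) *: (f + w *: g) - w *: (f + g).
  rewrite !scalerDr scalerA opprD addrACA -!scalerBl addrK scale1r; congr (_ + _ *: _).
  by ring.
apply: (scalerI w2n0); rewrite fg fwg -[RHS](addKr (q0 + w *: q1)) e addr0.
rewrite scalerBr !scalerA ww2 scale1r mulrDr mulr1 ww2 opprD addrC -scaleNr; congr (_ + _ *: _).
by apply: (eq_modulo 1 wE); ring.
Qed.

End CubePencil.

(** * From representations to matchings of the roots *)

Section Matchings.
Variable R : realType.
Local Notation C := R[i].
Local Notation x := (varx R).
Local Notation y := (vary R).
Local Notation w := (omega R).
Implicit Types (p q f g : {mpoly C[2]}) (a b c d : C) (t r : seq C) (s : set {mpoly C[2]}).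

(* [rep p t s]: [s] is given by a representation f, g of [p] whose factors f + w^j g have the
   roots t_(2j), t_(2j+1), the entries of [t] being points (a : 1) of the projective line. *)
Definition rep p t s := exists f g c0 c1 c2,
  [/\ f \is 2.-homog, g \is 2.-homog, ~ proportional f g,
      p = f ^+ 3 + g ^+ 3 & s = [set f ^+ 3; g ^+ 3]] /\
  [/\ f + g = c0 *: (lin t`_0 * lin t`_1),
      f + w *: g = c1 *: (lin t`_2 * lin t`_3) &
      f + w ^+ 2 *: g = c2 *: (lin t`_4 * lin t`_5)].

(** The product of the three factors has degree 6 after y = 1, so each factor keeps degree 2 and has
    two finite roots. Unique factorization identifies these six with [r]; positions are used because
    entries of [r] may repeat. *)
Lemma reps_rep p c r s : c != 0 -> size r = 6%N -> p = c *: \prod_(a <- r) lin a ->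
  reps p s -> exists2 I, perm_eq I (iota 0 6) & rep p [seq r`_i | i <- I] s.
Proof.
move=> c0 szr pE [f [g [hf hg nfg pfg ->]]].
have hq e : f + e *: g \is 2.-homog by rewrite rpredD ?dhomogZ.
have pM := pfg; rewrite sum_cubesE -{1}[g]scale1r in pM.
have dM := congr1 (@dehom R) pM; rewrite 2!rmorphM /= in dM.
have szp : size (dehom p) = 7 by rewrite pE dehomZ dehom_prod_lin size_scale // size_prod_XsubC szr.
have sz := szp; rewrite dM in sz.
have [sz0 sz1 sz2] := size_mul3_eq7 (size_dehom (hq 1)) (size_dehom (hq w)) (size_dehom (hq (w ^+
    2))) sz.
have [c0' [r0 [c0'0 szr0 q0E]]] := homog_split (hq 1) sz0.
have [c1' [r1 [c1'0 szr1 q1E]]] := homog_split (hq w) sz1.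
have [c2' [r2 [c2'0 szr2 q2E]]] := homog_split (hq (w ^+ 2)) sz2.
have perm : perm_eq (r0 ++ r1 ++ r2) r.
  apply: prod_XsubC_eq; rewrite !big_cat /=.
  have e : c *: \prod_(a <- r) ('X - a%:P) = (c0' * c1' * c2') *: (\prod_(a <- r0) ('X - a%:P) *
     (\prod_(a <- r1) ('X - a%:P) * \prod_(a <- r2) ('X - a%:P))).
    rewrite -dehom_prod_lin -dehomZ -pE dM q0E q1E q2E !dehomZ !dehom_prod_lin.
    by rewrite -!mul_polyC !rmorphM /=; ring.
  have ce : c0' * c1' * c2' = c.
    have := congr1 lead_coef e; rewrite !lead_coefZ !lead_coefM.
    have mon (u : seq C) : lead_coef (\prod_(a <- u) ('X - a%:P)) = 1.
      exact/monicP/monic_prod_XsubC.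
    by rewrite !mon !mulr1.
  by apply: (scalerI c0); rewrite e ce.
have [I permI mapI] := perm_iotaP 0 perm.
exists I; first by rewrite -szr.
rewrite -mapI.
case: r0 szr0 q0E {perm mapI} => [|a0 [|b0 []]] // _ q0E.
case: r1 szr1 q1E => [|a1 [|b1 []]] // _ q1E.
case: r2 szr2 q2E => [|a2 [|b2 []]] // _ q2E.
have pr a b : \prod_(e <- [:: a; b]) lin e = lin a * lin b by rewrite big_cons big_seq1.
rewrite pr scale1r in q0E; rewrite pr in q1E; rewrite pr in q2E.
exists f, g, c0', c1', c2'; split; first exact: And5.
by rewrite /=; apply: And3; [exact: q0E|exact: q1E|exact: q2E].
Qed.

Lemma rep_uniq p t s s' : rep p t s -> rep p t s' -> s = s'.
Proof.
move=> [f [g [c0 [c1 [c2 [[hf hg nfg pE ->] [e0 e1 e2]]]]]]].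
move=> [f' [g' [c0' [c1' [c2' [[hf' hg' nfg' pE' ->] [e0' e1' e2']]]]]]].
have nz e k q : f + e *: g = k *: q -> k != 0.
  move=> qE; apply/eqP => k0; rewrite k0 scale0r in qE.
  have := nproportional_neq0 (a := 1) (b := e) nfg; rewrite xpair_eqE oner_eq0 scale1r => /(_ isT).
  by rewrite qE eqxx.
have c00 : c0 != 0 by apply: (nz 1); rewrite scale1r; exact: e0.
have c10 := nz _ _ _ e1; have c20 := nz _ _ _ e2.
have h0 := scaler_ratio c00 e0 e0'.
have h1 := scaler_ratio c10 e1 e1'.
have h2 := scaler_ratio c20 e2 e2'.
have pE2 : f ^+ 3 + g ^+ 3 = f' ^+ 3 + g' ^+ 3 by rewrite -pE.
exact: (cubes_eq nfg pE2 h0 h1 h2).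
Qed.

Lemma rep_swap0 p a b c d a' b' s : rep p [:: a; b; c; d; a'; b'] s -> rep p [:: b; a; c; d; a';
    b'] s.
Proof.
move=> [f [g [c0 [c1 [c2 [H [e0 e1 e2]]]]]]]; exists f, g, c0, c1, c2; split; first exact: H.
split; [rewrite [lin _ * _]mulrC; exact: e0|exact: e1|exact: e2].
Qed.

Lemma rep_swap01 p a b c d a' b' s : rep p [:: a; b; c; d; a'; b'] s -> rep p [:: c; d; a; b; a';
    b'] s.
Proof.
move=> [f [g [c0 [c1 [c2 [[hf hg nfg pE sE] [e0 e1 e2]]]]]]].
have w3 := omega3 R; have g3 : (w *: g) ^+ 3 = g ^+ 3 by rewrite exprZn w3 scale1r.
exists (w *: g), f, c1, (w * c0), (w ^+ 2 * c2); split; first split.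
- exact: dhomogZ.
- exact: hf.
- move=> [u [v [uv h]]]; apply: nfg; exists v, (u * w); split.
    apply: contra uv; rewrite !xpair_eqE mulf_eq0 (negPf (omega_neq0 R)) orbF andbC; exact: id.
  by rewrite -h scalerA.
- by rewrite g3 addrC.
- by rewrite g3 setUC.
exact: (pencil_swap01 w3 e0 e1 e2).
Qed.

Lemma rep_swap12 p a b c d a' b' s : rep p [:: a; b; c; d; a'; b'] s -> rep p [:: a; b; a'; b'; c;
    d] s.
Proof.
move=> [f [g [c0 [c1 [c2 [[hf hg nfg pE sE] [e0 e1 e2]]]]]]].
exists g, f, c0, (w * c2), (w ^+ 2 * c1); split; first split.
- exact: hg.
- exact: hf.
- move=> [u [v [uv h]]]; apply: nfg; exists v, u; split; last exact: esym.
  apply: contra uv; rewrite !xpair_eqE andbC; exact: id.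
- by rewrite addrC.
- by rewrite setUC.
exact: (pencil_swap12 (omega3 R) e0 e1 e2).
Qed.

Lemma rep_swap1 p a b c d a' b' s : rep p [:: a; b; c; d; a'; b'] s -> rep p [:: a; b; d; c; a';
    b'] s.
Proof. by move/rep_swap01/rep_swap0/rep_swap01. Qed.

Lemma rep_swap2 p a b c d a' b' s : rep p [:: a; b; c; d; a'; b'] s -> rep p [:: a; b; c; d; b';
    a'] s.
Proof. by move/rep_swap12/rep_swap1/rep_swap12. Qed.

(** The relation sum of w^j (f + w^j g) = 0, evaluated at (z : 1); no factor is zero because f and g
    are not proportional. *)
Lemma rep_syzygy p t s : rep p t s -> exists e0 e1 e2,
  [/\ e0 != 0, e1 != 0, e2 != 0 & forall z,
   e0 * ((z - t`_0) * (z - t`_1)) + e1 * ((z - t`_2) * (z - t`_3)) +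
   e2 * ((z - t`_4) * (z - t`_5)) = 0].
Proof.
move=> [f [g [c0 [c1 [c2 [[hf hg nfg pE _] [q0 q1 q2]]]]]]].
have nz e k q : f + e *: g = k *: q -> k != 0.
  move=> qE; apply/eqP => k0; rewrite k0 scale0r in qE.
  have := nproportional_neq0 (a := 1) (b := e) nfg; rewrite xpair_eqE oner_eq0 scale1r => /(_ isT).
  by rewrite qE eqxx.
have c00 : c0 != 0 by apply: (nz 1); rewrite scale1r; exact: q0.
have c10 := nz _ _ _ q1; have c20 := nz _ _ _ q2.
exists c0, (w * c1), (w ^+ 2 * c2); split; rewrite ?mulf_neq0 ?expf_neq0 ?omega_neq0 // => z.
have evq e k a b : f + e *: g = k *: (lin a * lin b) -> k * ((z - a) * (z - b)) = ev z f + e * ev z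
    g.
  by move/(congr1 (ev z)); rewrite !evE.
apply: (pencil_relation (omegaP R)) (evq _ _ _ _ q1) (evq _ _ _ _ q2).
by rewrite -[ev z g]mul1r; apply: evq; rewrite scale1r; exact: q0.
Qed.

Lemma rep_det p t s : rep p t s -> syzygy_det t = 0.
Proof. by move/rep_syzygy => [e0 [e1 [e2 [n0 n1 n2 h]]]]; apply: (syzygy_det_eq0 n1 h). Qed.

Lemma rep_common p t s z : rep p t s ->
  [/\ (z - t`_0) * (z - t`_1) = 0 -> (z - t`_2) * (z - t`_3) = 0 -> (z - t`_4) * (z - t`_5) = 0,
      (z - t`_0) * (z - t`_1) = 0 -> (z - t`_4) * (z - t`_5) = 0 -> (z - t`_2) * (z - t`_3) = 0 &
      (z - t`_2) * (z - t`_3) = 0 -> (z - t`_4) * (z - t`_5) = 0 -> (z - t`_0) * (z - t`_1) = 0].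
Proof.
move/rep_syzygy => [e0 [e1 [e2 [n0 n1 n2 /(_ z) h]]]].
split=> a b; rewrite a b !mulr0 ?add0r ?addr0 in h.
- by apply: (mulfI n2); rewrite mulr0.
- by apply: (mulfI n1); rewrite mulr0.
- by apply: (mulfI n0); rewrite mulr0.
Qed.

End Matchings.

(** * From admissible matchings back to representations *)

Section RepCanon.
Variable R : realType.
Local Notation C := R[i].

Lemma rep_canonize (p : {mpoly C[2]}) (r : seq C) (I : seq nat) s : size I = 6%N ->
  rep p [seq r`_i | i <- canonize I] s <-> rep p [seq r`_i | i <- I] s.
Proof.
move=> szI; apply: (canonize_iff (fun J => rep p [seq r`_i | i <- J] s)) szI => a b c d e f.
- exact: rep_swap0.
- exact: rep_swap01.
- exact: rep_swap12.
Qed.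

Implicit Types (p f g : {mpoly C[2]}) (t : seq C) (s : set {mpoly C[2]}) (z : C).
Local Notation w := (omega R).
Local Notation x := (varx R).
Local Notation y := (vary R).

Lemma lin_mul (a b : C) : lin a * lin b = x ^+ 2 + (a + b) *: - (x * y) + (a * b) *: y ^+ 2.
Proof.
rewrite /lin -!mul_mpolyC rmorphD rmorphM /=; move: (a%:MP) (b%:MP) x y => A B X Y; ring.
Qed.

Lemma homog_lin_mul (a b : C) : lin a * lin b \is 2.-homog.
Proof. exact: (dhomogM (homog_lin a) (homog_lin b)). Qed.

(* Both forms are multiples of f + g. *)
Lemma proportional_ev f g z : proportional f g -> f + g != 0 -> ev z (f + g) = 0 ->
  ev z f = 0 /\ ev z g = 0.
Proof.
move=> [a [b [ab e]]] fg h.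
have abn : a + b != 0.
  apply: contra ab => h0; have bE : b = - a by apply/eqP; rewrite -addr_eq0 addrC.
  have : a *: (f + g) == 0 by rewrite scalerDr e bE scaleNr addNr.
  by rewrite scaler_eq0 (negPf fg) orbF => /eqP a0; rewrite bE a0 oppr0 eqxx.
have fE : (a + b) *: f = b *: (f + g) by rewrite scalerDl e -scalerDr addrC.
have gE : (a + b) *: g = a *: (f + g) by rewrite scalerDl -e -scalerDr addrC.
have fz := congr1 (ev z) fE; have gz := congr1 (ev z) gE.
rewrite !evZ h !mulr0 in fz gz.
by split; apply: (mulfI abn); rewrite mulr0.
Qed.

Lemma det_rep p (c a b a1 b1 a2 b2 : C) : c != 0 -> uniq [:: a; b; a1; b1; a2; b2] ->
  p = c *: (lin a * lin b * (lin a1 * lin b1) * (lin a2 * lin b2)) ->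
  syzygy_det [:: a; b; a1; b1; a2; b2] = 0 -> exists s, rep p [:: a; b; a1; b1; a2; b2] s.
Proof.
move=> c0 u pE /(syzygy_of_det _ _ _ _ _ _ u)[e0 [e1 [e2 [[n0 n1 n2] [E S P]]]]].
have w3 := omega3 R; have wE := omegaP R; have w1 := omega_neq1 R; have w0 := omega_neq0 R.
have rel : e0 *: (lin a * lin b) + e1 *: (lin a1 * lin b1) + e2 *: (lin a2 * lin b2) = 0.
  by rewrite 3!lin_mul; exact: dependent_sum.
(* Rescaling a relation by l keeps it a relation, and l is chosen so that the product of the factors
   is p. The powers of w inserted below turn it into q0 + w q1 + w^2 q2 = 0, and they cancel in the
   product. *)
pose l := 3.-root (c / (e0 * e1 * e2)).
have lE : l ^+ 3 * (e0 * e1 * e2) = c by rewrite rootCK // divfK // !mulf_neq0.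
have l0 : l != 0 by apply: contra c0 => /eqP l0; rewrite -lE l0 expr0n mul0r.
have [q0 q0E] := ex_eq ((l * e0) *: (lin a * lin b)).
have [q1 q1E] := ex_eq ((l * w ^+ 2 * e1) *: (lin a1 * lin b1)).
have [q2 q2E] := ex_eq ((l * w * e2) *: (lin a2 * lin b2)).
have q_rel : q0 + w *: q1 + w ^+ 2 *: q2 = 0.
  have -> : w *: q1 = (l * e1) *: (lin a1 * lin b1).
    rewrite q1E scalerA; congr (_ *: _); rewrite -[RHS]mul1r -w3; ring.
  have -> : w ^+ 2 *: q2 = (l * e2) *: (lin a2 * lin b2).
    rewrite q2E scalerA; congr (_ *: _); rewrite -[RHS]mul1r -w3; ring.
  by rewrite q0E -!(scalerA l) -!scalerDr rel scaler0.
have [f [g [k [[gE fE] [fg fwg fw2g]]]]] := pencil_of_relation wE w1 q_rel.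
have hq0 : q0 \is 2.-homog by rewrite q0E; exact: (dhomogZ _ (homog_lin_mul _ _)).
have hq1 : q1 \is 2.-homog by rewrite q1E; exact: (dhomogZ _ (homog_lin_mul _ _)).
have hg : g \is 2.-homog by rewrite gE; exact: (dhomogZ _ (rpredB hq0 hq1)).
have hf : f \is 2.-homog by rewrite fE; exact: (rpredB hq0 hg).
exists [set f ^+ 3; g ^+ 3], f, g, (l * e0), (l * w ^+ 2 * e1), (l * w * e2); split; last first.
  by rewrite -q0E -q1E -q2E.
split=> //.
(* If f and g were proportional, both would vanish at the root a of f + g, and so would f + w g,
   whose roots are a1 and b1. *)
- move=> pr; have q00 : q0 != 0.
    by rewrite q0E scaler_eq0 negb_or (mulf_neq0 l0 n0) (mulf_neq0 (lin_neq0 a) (lin_neq0 b)).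
  have q0a : ev a q0 = 0 by rewrite q0E !evE subrr mul0r mulr0.
  rewrite -fg in q00 q0a; have [fa ga] := proportional_ev pr q00 q0a.
  have : ev a q1 = 0 by rewrite -fwg evD evZ fa ga mulr0 addr0.
  rewrite q1E !evE => /eqP; rewrite !mulf_eq0 (negPf l0) (negPf w0) (negPf n1) /= !subr_eq0.
  by move: u; rewrite /= !inE !negb_or -!andbA => /and5P[_ /negPf-> /negPf-> _ _].
- rewrite sum_cubesE fg fwg fw2g pE q0E q1E q2E scaler_mul3; congr (_ *: _).
  by rewrite -lE -[LHS]mulr1 -w3; ring.
Qed.

End RepCanon.

(** * A representation determines its matching; repeated roots *)

Section Cross.
Variable R : realType.
Local Notation C := R[i].
Implicit Types (p f g : {mpoly C[2]}) (t r : seq C) (s : set {mpoly C[2]}) (z : C).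
Local Notation w := (omega R).

Lemma cube_eq_scale f g : f ^+ 3 = g ^+ 3 -> exists k, f = k *: g.
Proof.
move=> e; have : f ^+ 3 + (- g) ^+ 3 = 0.
  by rewrite exprNn -signr_odd /= mulN1r e subrr.
have key k : f + k *: - g = 0 -> exists k, f = k *: g.
  by rewrite scalerN => /eqP; rewrite subr_eq0 => /eqP ->; exists k.
rewrite sum_cubesE => /eqP; rewrite !mulf_eq0 -orbA => /or3P[] /eqP h; last 2 first.
- exact: key h.
- exact: key h.
by apply: (key 1); rewrite scale1r.
Qed.

(* For distinct roots this says that z and z' lie in the same quadratic factor. The condition
   depends only on the cubes, so that [s] determines the matching. *)
Definition cross s z z' := exists f g, s = [set f ^+ 3; g ^+ 3] /\
  ev z f * ev z' g = ev z' f * ev z g.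

Lemma cross_any s z z' f g : cross s z z' -> s = [set f ^+ 3; g ^+ 3] ->
  ev z f * ev z' g = ev z' f * ev z g.
Proof.
move=> [f' [g' [-> h]]] /set2_eq[] [/esym/cube_eq_scale[k ->] /esym/cube_eq_scale[l ->]]; rewrite
    !evZ.
  by rewrite mulrACA h mulrACA.
by rewrite mulrACA [ev z g' * _]mulrC -h [ev z f' * _]mulrC mulrACA.
Qed.

Lemma rep_cross p a b a1 b1 a2 b2 s : rep p [:: a; b; a1; b1; a2; b2] s -> cross s a b.
Proof.
move=> [f [g [c0 [c1 [c2 [[_ _ _ _ ->] [e0 _ _]]]]]]].
have fE z : (z - a) * (z - b) = 0 -> ev z f = - ev z g.
  by move=> h; apply/eqP; rewrite -addr_eq0 -evD e0 !evE h mulr0.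
exists f, g; split=> //; rewrite (fE a) ?subrr ?mul0r // (fE b) ?subrr ?mulr0 //.
by rewrite !mulNr mulrC.
Qed.

(** The ratio f / g is -1 at a, so z crossing a is also a zero of f + g. The ratio makes sense: if
    g(a) = 0, then f + w g would vanish at a as well. *)
Lemma cross_rep p a b a1 b1 a2 b2 s z : rep p [:: a; b; a1; b1; a2; b2] s ->
  uniq [:: a; b; a1; b1; a2; b2] -> cross s a z -> z = a \/ z = b.
Proof.
move=> [f [g [c0 [c1 [c2 [[hf hg nfg pE ->] [e0 e1 e2]]]]]]] u /cross_any/(_ erefl) h.
have nz e k q : f + e *: g = k *: q -> k != 0.
  move=> qE; apply/eqP => k0; rewrite k0 scale0r in qE.
  have := nproportional_neq0 (a := 1) (b := e) nfg; rewrite xpair_eqE oner_eq0 scale1r => /(_ isT).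
  by rewrite qE eqxx.
have c10 := nz _ _ _ e1.
have c00 : c0 != 0 by apply: (nz 1); rewrite scale1r; exact: e0.
have faE : ev a f = - ev a g.
  by apply/eqP; rewrite -addr_eq0 -evD e0 !evE subrr mul0r mulr0.
have ga : ev a g != 0.
  apply/eqP => ga; have : ev a (f + w *: g) = 0 by rewrite evD evZ faE ga mulr0 oppr0 addr0.
  rewrite e1 !evE => /eqP; rewrite !mulf_eq0 (negPf c10) !subr_eq0.
  by move: u; rewrite /= !inE !negb_or -!andbA => /and5P[_ /negPf-> /negPf-> _ _].
have : ev z (f + g) = 0.
  by apply: (mulfI ga); rewrite mulr0 evD mulrDr [ev a g * ev z f]mulrC -h faE mulNr addNr.
rewrite e0 !evE => /eqP; rewrite !mulf_eq0 (negPf c00) !subr_eq0 /= => /orP[] /eqP; [by left|by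
    right].
Qed.

Lemma rep_mate p r s m i : m \in matchings -> (i < 6)%N -> rep p [seq r`_j | j <- m] s ->
  exists J, perm_eq (i :: mate m i :: J) (iota 0 6) /\
    rep p [seq r`_j | j <- i :: mate m i :: J] s.
Proof.
move=> /matchings_perm pm i6 h.
have im : i \in m by rewrite (perm_mem pm) mem_iota.
have szm := perm_size pm; rewrite size_iota in szm.
have k6 : (index i m < 6)%N by rewrite -szm index_mem.
suff main k : (k < 6)%N ->
    exists J, perm_eq (nth 0%N m k :: nth 0%N m (if odd k then k.-1 else k.+1) :: J) (iota 0 6) /\
    rep p [seq r`_j | j <- nth 0%N m k :: nth 0%N m (if odd k then k.-1 else k.+1) :: J] s.
  by have := main _ k6; rewrite nth_index.
move=> {i i6 im k6} k6.
case: m pm szm h => [|m0 [|m1 [|m2 [|m3 [|m4 [|m5 []]]]]]] // pm _ h.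
have pt (t : seq nat) : perm_eq t [:: m0; m1; m2; m3; m4; m5] -> perm_eq t (iota 0 6) by
    move/perm_trans; apply.
case: k k6 => [_|[_|[_|[_|[_|[_|//]]]]]] /=.
- by exists [:: m2; m3; m4; m5].
- exists [:: m2; m3; m4; m5]; split; last exact: rep_swap0.
  by apply: pt; apply/permP => q /=; lia.
- exists [:: m0; m1; m4; m5]; split; last exact: rep_swap01.
  by apply: pt; apply/permP => q /=; lia.
- exists [:: m0; m1; m4; m5]; split; last by apply/rep_swap01/rep_swap1.
  by apply: pt; apply/permP => q /=; lia.
- exists [:: m0; m1; m2; m3]; split; last by apply/rep_swap01/rep_swap12.
  by apply: pt; apply/permP => q /=; lia.
- exists [:: m0; m1; m2; m3]; split; last by apply/rep_swap01/rep_swap12/rep_swap2.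
  by apply: pt; apply/permP => q /=; lia.
Qed.

Lemma rep_matching_inj p r s m m' : uniq r -> size r = 6%N -> m \in matchings -> m' \in matchings ->
  rep p [seq r`_i | i <- m] s -> rep p [seq r`_i | i <- m'] s -> m = m'.
Proof.
move=> ur szr hm hm' h h'; apply: mate_inj => //; apply/allP => i; rewrite mem_iota /= add0n => i6.
have [J [pJ rJ]] := rep_mate hm i6 h; have [J' [pJ' rJ']] := rep_mate hm' i6 h'.
have szJ := perm_size pJ; have szJ' := perm_size pJ'.
have inj : {in iota 0 6 &, injective (fun j => r`_j)}.
  by move=> j k; rewrite !mem_iota /= => j6 k6 /eqP; rewrite nth_uniq ?szr // => /eqP.
have mem6 (K : seq nat) : perm_eq K (iota 0 6) -> {in K, forall j, j \in iota 0 6}.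
  by move=> pK j; rewrite (perm_mem pK).
have uJ : uniq [seq r`_j | j <- i :: mate m i :: J].
  by rewrite map_inj_in_uniq ?(perm_uniq pJ) // => j k /(mem6 _ pJ) hj /(mem6 _ pJ); apply: inj.
have uJ' := perm_uniq pJ'.
have nei : mate m' i != i.
  by move: uJ' => /=; rewrite inE negb_or eq_sym => /andP[/andP[]].
case: J szJ rJ uJ pJ => [|j0 [|j1 [|j2 [|j3 []]]]] // _ rJ uJ pJ.
case: J' szJ' rJ' pJ' {uJ'} => [|k0 [|k1 [|k2 [|k3 []]]]] // _ rJ' pJ'.
have [/inj|/inj] := cross_rep rJ uJ (rep_cross rJ').
  rewrite !(mem6 _ pJ') ?inE ?eqxx ?orbT // => /(_ isT isT) e; move: nei; rewrite e eqxx //.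
by rewrite (mem6 _ pJ') ?(mem6 _ pJ) ?inE ?eqxx ?orbT // => /(_ isT isT) ->.
Qed.

Lemma rep_triple p a t s : size t = 6%N -> rep p t s ->
  [&& (a == t`_0) || (a == t`_1), (a == t`_2) || (a == t`_3) & (a == t`_4) || (a == t`_5)] ->
  exists u, [/\ size u = 3%N, perm_eq [:: a, a, a & u] t & rep p [:: a; u`_0; a; u`_1; a; u`_2] s].
Proof.
case: t => [|t0 [|t1 [|t2 [|t3 [|t4 [|t5 []]]]]]] // _.
have E0 b c d e b' c' : rep p [:: b; c; d; e; b'; c'] s -> (a == b) || (a == c) ->
    exists u, (perm_eq [:: a; u] [:: b; c]) /\ rep p [:: a; u; d; e; b'; c'] s.
  move=> h /orP[] /eqP ->; first by exists c.
  by exists b; split; [apply/permP => q /=; lia|exact: rep_swap0].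
move=> h /= /and3P[/(E0 _ _ _ _ _ _ h)[u0 [p0 {}h]]].
move=> /(E0 _ _ _ _ _ _ (rep_swap01 h))[u1 [p1 /rep_swap12/rep_swap01 {}h]].
move=> /(E0 _ _ _ _ _ _ h)[u2 [p2 {}h]].
exists [:: u0; u1; u2]; split; [exact: erefl| |exact: (rep_swap01 (rep_swap12 (rep_swap01 h)))].
apply: (perm_trans _ (perm_cat p0 (perm_cat p1 p2))).
by apply/permP => q /=; lia.
Qed.

(** When a occupies a place in every pair, the matching is given by the three other roots up to
    order, and a permutation of the pairs does not change the representation. *)
Lemma rep_triple_uniq p a (u u' : seq C) s s' : size u = 3%N -> perm_eq u' u ->
  rep p [:: a; u`_0; a; u`_1; a; u`_2] s -> rep p [:: a; u'`_0; a; u'`_1; a; u'`_2] s' -> s = s'.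
Proof.
move=> szu pu h h'; apply: rep_uniq h'.
apply: (@seq3_perm_ind _ (fun v => rep p [:: a; v`_0; a; v`_1; a; v`_2] s) _ _ _ _ szu pu h) => b c
    d.
  exact: rep_swap01.
exact: rep_swap12.
Qed.

(** By [hexagon_cover] a repeated root lies in every pair of both matchings. Removing three copies
    of it leaves the same multiset for both, so the representations agree. *)
Lemma hexagon_uniq p t s s' : size t = 6%N -> rep p t s -> rep p (rot 1 t) s' -> s <> s' -> uniq t.
Proof.
move=> szt h h' ne; apply/negPn/negP => /(uniqPn 0)[i [j [ij j6 e]]]; apply: ne.
pose b k := t`_i == t`_k.
have sum2 : (2 <= b 0 + b 1 + b 2 + b 3 + b 4 + b 5)%N.
  have bi : b i by rewrite /b. have bj : b j by rewrite /b e.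
  rewrite szt in j6; clear - ij j6 bi bj; move: b bi bj => b bi bj.
  have i6 : (i < 6)%N by lia.
  by case: i i6 ij bi => [|[|[|[|[|[|//]]]]]] _; case: j j6 bj => [|[|[|[|[|[|//]]]]]] // _ bj _ bi;
    rewrite bi bj; lia.
have mulb k l : ((t`_i - t`_k) * (t`_i - t`_l) == 0) = b k || b l by rewrite mulf_eq0 !subr_eq0.
have imp (x y z : C) : (x = 0 -> y = 0 -> z = 0) -> (x == 0) && (y == 0) ==> (z == 0).
  by move=> hx; apply/implyP => /andP[/eqP/hx hy /eqP/hy ->].
have /andP[A A'] : [&& b 0 || b 1, b 2 || b 3 & b 4 || b 5] && [&& b 1 || b 2, b 3 || b 4 & b 5 ||
    b 0].
  apply: hexagon_cover sum2 _ _.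
    by have [/imp r1 /imp r2 /imp r3] := rep_common t`_i h; rewrite -!mulb; apply/and3P.
  have [/imp r1 /imp r2 /imp r3] := rep_common t`_i h'.
  move: r1 r2 r3; rewrite -!mulb; move: (t`_i); clear - szt.
  by case: t szt => [|t0 [|t1 [|t2 [|t3 [|t4 [|t5 []]]]]]] // _ z r1 r2 r3; apply/and3P.
have [u [szu pu hu]] := rep_triple szt h A.
have szt' : size (rot 1 t) = 6%N by rewrite size_rot.
have [|u' [szu' pu' hu']] := rep_triple (a := t`_i) szt' h'.
  move: A'; rewrite /b; move: (t`_i); clear - szt.
  by case: t szt => [|t0 [|t1 [|t2 [|t3 [|t4 [|t5 []]]]]]].
apply: (rep_triple_uniq szu _ hu hu').
have : perm_eq [:: t`_i, t`_i, t`_i & u'] [:: t`_i, t`_i, t`_i & u].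
  by apply: perm_trans pu' _; rewrite perm_sym; apply: perm_trans pu _; rewrite perm_sym perm_rot.
by rewrite !perm_cons.
Qed.

End Cross.

(** * Reduction of a hexagon with a fourth matching to the two special sextics *)

Section NormalForms.
Variable R : realType.
Local Notation C := R[i].
Local Notation x := (varx R).
Local Notation y := (vary R).
Local Notation w := (omega R).
Implicit Types (p q f g : {mpoly C[2]}) (t r z : seq C) (s : set {mpoly C[2]}) (a b c d k : C).

Definition prod_lin t : {mpoly C[2]} := \prod_(a <- t) lin a.

Lemma prod_lin6 a b c d a' b' : prod_lin [:: a; b; c; d; a'; b'] =
  lin a * lin b * (lin c * lin d) * (lin a' * lin b').
Proof. exact: big_prod6. Qed.

Lemma homog_prod_lin6 t : size t = 6%N -> prod_lin t \is 6.-homog.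
Proof. by move=> <-; apply: homog_prod_lin. Qed.

Lemma lin_subst (u1 u0 v1 v0 a k : C) : u1 * v0 - u0 * v1 != 0 ->
  u1 * a + u0 = k * (v1 * a + v0) ->
  lin a = ((v1 * a + v0) / (u1 * v0 - u0 * v1)) *: subst u1 u0 v1 v0 (lin k) /\ v1 * a + v0 != 0.
Proof.
move=> D0 e; have V0 : v1 * a + v0 != 0.
  apply/eqP => V0; have /eqP := D0; apply; rewrite V0 mulr0 in e.
  by rewrite [LHS](_ : _ = u1 * (v1 * a + v0) - v1 * (u1 * a + u0)); [rewrite V0 e !mulr0
      subrr|ring].
split=> //; have -> : subst u1 u0 v1 v0 (lin k) = (u1 - k * v1) *: x + (u0 - k * v0) *: y.
  rewrite /lin rmorphB /= substZ substx substy scalerDr !scalerA opprD addrACA.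
  by rewrite -!scalerBl.
have -> : lin a = 1 *: x + (- a) *: y by rewrite /lin scale1r scaleNr.
rewrite scalerDr !scalerA.
congr (_ *: _ + _ *: _); apply: (mulIf D0); rewrite mulrAC divfK //.
  rewrite mul1r [RHS](_ : _ = u1 * (v1 * a + v0) - v1 * (k * (v1 * a + v0))); last by ring.
  by rewrite -e; ring.
rewrite [RHS](_ : _ = u0 * (v1 * a + v0) - v0 * (k * (v1 * a + v0))); last by ring.
by rewrite -e; ring.
Qed.

Lemma prod_lin_subst (u1 u0 v1 v0 : C) t z : size t = size z ->
  (forall i, (i < size t)%N -> exists2 c, c != 0 & lin t`_i = c *: subst u1 u0 v1 v0 (lin z`_i)) ->
  exists2 c, c != 0 & prod_lin t = c *: subst u1 u0 v1 v0 (prod_lin z).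
Proof.
rewrite /prod_lin; elim: t z => [|a t IH] [|b z] // sz h.
  by exists 1; rewrite ?oner_neq0 // !big_nil rmorph1 scale1r.
have [c c0 cE] := h 0%N isT.
have [|i it|d d0 dE] := IH z; first by case: sz.
  exact: (h i.+1 it).
exists (c * d); first by rewrite mulf_neq0.
rewrite !big_cons dE cE rmorphM /= -scalerAl -scalerAr scalerA; congr (_ *: _).
Qed.

Lemma hexagon_similar t : uniq t -> size t = 6%N -> syzygy_det t = 0 -> syzygy_det (rot 1 t) = 0 ->
  exists k, [/\ k != 0, similar_form (prod_lin t) (prod_lin (hexagon_roots w k)),
    k != 1, k * w != 1 & forall I, perm_eq I (iota 0 6) -> syzygy_det [seq t`_i | i <- I] = 0 ->
      syzygy_det [seq (hexagon_roots w k)`_i | i <- I] = 0].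
Proof.
move=> ut szt D D'.
have [u1 [u0 [v1 [v0 [k [D0 k0 h]]]]]] := hexagon_moebius (omegaP R) (omega_neq1 R) ut szt D D'.
(* Injectivity of the Moebius map: distinct roots have distinct images, which below excludes k = 1
   and k w = 1. *)
have inj i j : (i < 6)%N -> (j < 6)%N -> (hexagon_roots w k)`_i = (hexagon_roots w k)`_j -> i = j.
  move=> i6 j6 e; apply/eqP; rewrite -(nth_uniq 0 _ _ ut) ?szt //; apply/eqP.
  have [Vi Vj] := (proj2 (lin_subst D0 (h i i6)), proj2 (lin_subst D0 (h j j6))).
  apply: (mulfI D0); apply/eqP; rewrite -subr_eq0; apply/eqP.
  transitivity ((u1 * t`_i + u0) * (v1 * t`_j + v0) - (u1 * t`_j + u0) * (v1 * t`_i + v0)); first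
      by ring.
  by rewrite (h i i6) (h j j6) e; ring.
exists k; split=> //.
- have [|i|c c0 e] := @prod_lin_subst u1 u0 v1 v0 t (hexagon_roots w k); first by rewrite szt.
    rewrite szt => i6; have [e V0] := lin_subst D0 (h i i6).
    by exists ((v1 * t`_i + v0) / (u1 * v0 - u0 * v1)); rewrite // mulf_neq0 // invr_eq0.
  rewrite e; apply: similar_sym; apply: (similar_trans (similar_subst _ D0)).
  by apply: (@similar_scale R 6); rewrite // homog_subst // homog_prod_lin6.
- by apply/eqP => k1; have := @inj 1%N 0%N isT isT k1.
(* If k w = 1 then k = w^2, and vertices 1 and 4 collide. *)
- apply/eqP => kw1; suff : (hexagon_roots w k)`_1 = (hexagon_roots w k)`_4 by move/(inj 1%N 4%N isT
    isT).
  by rewrite /= -[k]mulr1 -(omega3 R) exprS mulrA kw1 mul1r.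
move=> I pI DI; apply: (moebius_syzygy_det D0 _ _ DI).
- rewrite map_inj_in_uniq ?(perm_uniq pI) // => i j; rewrite !(perm_mem pI) !mem_iota /= => i6 j6
    /eqP.
  by rewrite nth_uniq ?szt // => /eqP.
- by rewrite size_map (perm_size pI).
move=> i i6; have szI := perm_size pI.
rewrite !(nth_map 0%N) ?szI //; apply: h.
by have := mem_nth 0%N (_ : (i < size I)%N); rewrite szI (perm_mem pI) mem_iota => /(_ i6).
Qed.

Lemma prod_hexagon k : prod_lin (hexagon_roots w k) =
  x ^+ 6 - (1 + k ^+ 3) *: (x ^+ 3 * y ^+ 3) + k ^+ 3 *: y ^+ 6.
Proof.
have linE a : lin a = x + a *: - y by rewrite /lin scalerN.
have -> : prod_lin (hexagon_roots w k) = (x ^+ 3 + (- y) ^+ 3) * (x ^+ 3 + (k *: - y) ^+ 3).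
  rewrite prod_lin6 !sum_cubesE !linE scale1r !scalerA [w * k]mulrC [w ^+ 2 * k]mulrC.
  move: (x + - y) (x + w *: - y) (x + w ^+ 2 *: - y) (x + k *: - y) (x + (k * w) *: - y) (x + (k *
      w ^+ 2) *: - y).
  by move=> l0 l2 l4 l1 l5 l3; ring.
rewrite -!mul_mpolyC mpolyCD mpolyC1 rmorphXn /=; move: x y (k%:MP) => X Y K. ring.
Qed.

Definition diag_sextic (b e : C) := x ^+ 6 + b *: (x ^+ 3 * y ^+ 3) + e *: y ^+ 6.

Lemma subst_diag_sextic (u b e : C) :
  subst 1 0 0 u (diag_sextic b e) = diag_sextic (b * u ^+ 3) (e * u ^+ 6).
Proof.
have hx n : subst 1 0 0 u (x ^+ n) = x ^+ n by rewrite substXn substx scale1r scale0r addr0.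
have hy n : subst 1 0 0 u (y ^+ n) = u ^+ n *: y ^+ n.
  by rewrite substXn substy scale0r add0r exprZn.
exact: (morph_diag_sextic (substD 1 0 0 u) (substZ 1 0 0 u) (substM 1 0 0 u)
  (hx 6%N) (hx 3%N) (hy 3%N) (hy 6%N)).
Qed.

Lemma sexticB_diag c : sexticB c = diag_sextic c 1.
Proof. by rewrite /diag_sextic scale1r. Qed.

Lemma hexagon_diag k : prod_lin (hexagon_roots w k) = diag_sextic (- (1 + k ^+ 3)) (k ^+ 3).
Proof. by rewrite prod_hexagon /diag_sextic scaleNr. Qed.

Lemma Q1_diag : Q1 R = diag_sextic 0 1.
Proof. by rewrite /diag_sextic scale0r addr0 scale1r. Qed.

Lemma similar_diag (u : C) p : u != 0 -> similar_form p (subst 1 0 0 u p).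
Proof. by move=> u0; apply: similar_subst; rewrite mul1r mulr0 subr0. Qed.

Lemma hexagon_Q1 : similar_form (prod_lin (hexagon_roots w (- 1))) (Q1 R).
Proof.
have z6 : (6.-root (- 1 : C)) ^+ 6 = - 1 by exact: rootCK.
move: (6.-root _) z6 => u z6; apply: similar_sym.
have u0 : u != 0.
  apply/eqP => u0; move: z6; rewrite u0 expr0n => /eqP.
  by rewrite eq_sym oppr_eq0 oner_eq0.
rewrite Q1_diag hexagon_diag; have := similar_diag (diag_sextic 0 1) u0.
rewrite subst_diag_sextic z6; have -> : 0 * u ^+ 3 = - (1 + (- 1) ^+ 3) by ring.
by have -> : 1 * (- 1) = (- 1) ^+ 3 :> C by ring.
Qed.

Lemma sexticB_opp (b : C) : similar_form (sexticB b) (sexticB (- b)).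
Proof.
have u0 : - 1 != 0 :> C by rewrite oppr_eq0 oner_eq0.
rewrite !sexticB_diag; have := similar_diag (diag_sextic b 1) u0; rewrite subst_diag_sextic.
have -> : b * (- 1) ^+ 3 = - b by ring.
by have -> : 1 * (- 1) ^+ 6 = 1 :> C by ring.
Qed.

Local Notation s2 := (sqrtC (- 2 : C)).

Lemma sexticB_50 (b : C) : b ^+ 2 = - 50 -> similar_form (sexticB b) (sexticB (5 * s2)).
Proof.
have e2 : (5 * s2) ^+ 2 = - 50 by rewrite exprMn sqrtCK; ring.
rewrite -e2 => /eqP; rewrite eqf_sqr => /orP[] /eqP ->; first exact: similar_refl.
by have := sexticB_opp (- (5 * s2)); rewrite opprK.
Qed.

(** Replacing y by y / u with u^2 = k makes the last coefficient 1; the middle one becomes - (1 +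
    k^3) / u^3, with square -50. *)
Lemma hexagon_sexticB k : k != 0 -> (1 + k ^+ 3) ^+ 2 = - 50 * k ^+ 3 ->
  similar_form (prod_lin (hexagon_roots w k)) (sexticB (5 * s2)).
Proof.
move=> k0 e; have := sqrtCK k; move: (sqrtC k) => u uE.
have u0 : u != 0 by apply: contra_neq k0 => u0; rewrite -uE u0 expr0n.
apply: (similar_trans _ (sexticB_50 (b := - ((1 + k ^+ 3) / u ^+ 3)) _)); last first.
  rewrite sqrrN expr_div_n e -uE -!exprM; apply: mulfK; exact: expf_neq0.
have k3 : k ^+ 3 != 0 by exact: expf_neq0.
have v0 : u^-1 != 0 by rewrite invr_eq0.
rewrite sexticB_diag hexagon_diag; have := similar_diag (diag_sextic (- (1 + k ^+ 3)) (k ^+ 3)) v0.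
rewrite subst_diag_sextic; have -> : k ^+ 3 * u^-1 ^+ 6 = 1 by rewrite exprVn (exprM u 2 3) uE
    divff.
by rewrite exprVn mulNr.
Qed.

Lemma pattern_perm j : (j < 3)%N -> perm_eq (nth [::] patterns j) (iota 0 6).
Proof. by case: j => [|[|[|]]]. Qed.

Lemma omega_neq_half : 1 + 2 * w != 0.
Proof.
have e : (1 + 2 * w) ^+ 2 = - 3 by apply: (eq_modulo 4 (omegaP R)); ring.
by rewrite -sqrf_eq0 e oppr_eq0 pnatr_eq0.
Qed.

Lemma octahedral_eq k : k ^+ 2 + 4 * k + 1 = 0 -> (1 + k ^+ 3) ^+ 2 = - 50 * k ^+ 3.
Proof.
by move=> e; apply: (eq_modulo (1 - 4 * k + 15 * k ^+ 2 - 4 * k ^+ 3 + k ^+ 4) e); ring.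
Qed.

Lemma hexagon_form t j : uniq t -> size t = 6%N -> syzygy_det t = 0 -> syzygy_det (rot 1 t) = 0 ->
  (j < 3)%N -> syzygy_det [seq t`_i | i <- nth [::] patterns j] = 0 ->
  similar_form (prod_lin t) (if j == 0%N then Q1 R else sexticB (5 * s2)).
Proof.
move=> ut szt D D' j3 Dj; have [k [k0 sim k1 kw1 tr]] := hexagon_similar ut szt D D'.
have := tr _ (pattern_perm j3) Dj; move: sim; case: j {Dj} j3 => [|[|[|//]]] _ sim h.
- have := etrans (esym (@hexagon_roots_det0 _ w k (omegaP R))) h.
  move=> /eqP; rewrite !mulf_eq0 (negPf k0) (negPf omega_neq_half) oppr_eq0 pnatr_eq0 !orbF /=.
  rewrite addrC addr_eq0 => /eqP kE; rewrite kE in sim.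
  exact: (similar_trans sim hexagon_Q1).
- have := etrans (esym (@hexagon_roots_det1 _ w k (omegaP R))) h.
  move=> /eqP; rewrite mulf_eq0 subr_eq0 (negPf kw1) /= => /eqP/octahedral_eq e.
  apply: (similar_trans sim); apply: hexagon_sexticB => //.
  by move: e; rewrite exprMn omega3 mulr1.
- have := etrans (esym (@hexagon_roots_det2 _ w k (omegaP R))) h.
  move=> /eqP; rewrite mulf_eq0 subr_eq0 (negPf k1) /= => /eqP/octahedral_eq e.
  exact: (similar_trans sim (hexagon_sexticB k0 e)).
Qed.

End NormalForms.

(** * Counting representations and the classification *)

Section Counting.
Variable R : realType.
Local Notation C := R[i].
Local Notation x := (varx R).
Local Notation y := (vary R).
Local Notation w := (omega R).
Implicit Types (p q f g : {mpoly C[2]}) (t r z : seq C) (s : set {mpoly C[2]}) (a b c d : C).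

Lemma sexticA_E (c : C) : sexticA c =
  x ^+ 6 + c%:MP * (x ^+ 4 * y ^+ 2) + c%:MP * (x ^+ 2 * y ^+ 4) + y ^+ 6.
Proof. by rewrite 2!mul_mpolyC. Qed.

Lemma mpolyC_nat (n : nat) : (n%:R : C)%:MP = n%:R :> {mpoly C[2]}.
Proof. exact: rmorph_nat. Qed.

Lemma sqrC_i : ('i : C) ^+ 2 + 1 = 0.
Proof. by rewrite sqrCi addNr. Qed.

Lemma sqrC_2 : (sqrtC 2 : C) ^+ 2 - 2 = 0.
Proof. by rewrite sqrtCK subrr. Qed.

Lemma sexticA_octahedron (i s : C) : i ^+ 2 + 1 = 0 -> s ^+ 2 - 2 = 0 ->
  sexticA (- 5 : C) = prod_lin (octahedron i s).
Proof.
move=> iE sE; rewrite sexticA_E mpolyCN mpolyC_nat /octahedron prod_lin6 /lin -!mul_mpolyC.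
have iE' : (i%:MP : {mpoly C[2]}) ^+ 2 + 1 = 0.
  by rewrite -rmorphXn -mpolyC1 -mpolyCD iE mpolyC0.
have sE' : (s%:MP : {mpoly C[2]}) ^+ 2 - 2 = 0.
  by rewrite -rmorphXn -(mpolyC_nat 2) -mpolyCB sE mpolyC0.
rewrite !(mpolyCB, mpolyCD, mpolyCN, mpolyC1).
rewrite (octahedron_identity _ _ x y iE' sE').
by ring.
Qed.

Lemma Q2_sexticA : similar_form (Q2 R) (sexticA (- 5 : C)).
Proof.
(* With m = u l, the choice u^4 = -1 yields m^4 = - l^4, and l^6 = 1 / (2 u) yields 2 l^5 m = 1. *)
have [u uE] : exists u : C, u ^+ 4 = - 1 by exists (4.-root (- 1)); exact: rootCK.
have [l lE] : exists l : C, l ^+ 6 = (2 * u)^-1 by exists (6.-root (2 * u)^-1); exact: rootCK.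
have u0 : u != 0.
  by apply/eqP => u0; move: uE; rewrite u0 expr0n => /eqP; rewrite eq_sym oppr_eq0 oner_eq0.
have two : 2 != 0 :> C by rewrite pnatr_eq0.
have l0 : l != 0.
  apply/eqP => l0; move: lE; rewrite l0 expr0n => /eqP.
  by rewrite eq_sym invr_eq0 mulf_eq0 (negPf two) (negPf u0).
have lmE : 2 * l ^+ 5 * (u * l) = 1.
  by rewrite [LHS](_ : _ = 2 * u * l ^+ 6); [rewrite lE divff // mulf_neq0|ring].
have mE : (u * l) ^+ 4 = - l ^+ 4 by rewrite exprMn uE mulN1r.
move: (u * l) (mulf_neq0 u0 l0) lmE mE => m m0 lmE mE {uE lE u0 u}.
have [i iE] : exists i : C, i ^+ 2 + 1 = 0 by exists 'i; exact: sqrC_i.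
have i0 : i != 0.
  by apply/eqP => i0; move: iE; rewrite i0 expr0n add0r => /eqP; rewrite oner_eq0.
have -> : sexticA (- 5 : C) = subst l (l * i) m (- (m * i)) (Q2 R).
  rewrite sexticA_E mpolyCN mpolyC_nat /Q2 substM substM substB 2!substXn substx substy.
  have iE' : (i%:MP : {mpoly C[2]}) ^+ 2 + 1 = 0.
    by rewrite -rmorphXn -mpolyC1 -mpolyCD iE mpolyC0.
  have mE' : (m%:MP : {mpoly C[2]}) ^+ 4 = - (l%:MP) ^+ 4 by rewrite -2!rmorphXn mE /= mpolyCN.
  have lmE' : 2 * (l%:MP : {mpoly C[2]}) ^+ 5 * m%:MP = 1.
    by rewrite -(mpolyC_nat 2) -rmorphXn /= -2!mpolyCM lmE mpolyC1.
  rewrite scaleNr -!mul_mpolyC !mpolyCM (Q2_octahedron_identity _ _ _ x y iE' mE' lmE').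
  by ring.
apply: similar_subst; rewrite [X in X != 0](_ : _ = - (2 * l * m * i)); last by ring.
by rewrite oppr_eq0 !mulf_neq0.
Qed.

Lemma Q1_sexticA : similar_form (Q1 R) (sexticA (15 : C)).
Proof.
have two : 2 != 0 :> C by rewrite pnatr_eq0.
have [l lE] : exists l : C, 2 * l ^+ 6 = 1.
  by exists (6.-root 2^-1); rewrite rootCK // divff.
have l0 : l != 0.
  by apply/eqP => l0; move: lE; rewrite l0 expr0n mulr0 => /eqP; rewrite eq_sym oner_eq0.
have -> : sexticA (15 : C) = subst l l l (- l) (Q1 R).
  have h6 q q' : subst l l l (- l) q = q' -> subst l l l (- l) (q ^+ 6) = q' ^+ 6.
    by move=> <-; exact: substXn.
  rewrite sexticA_E mpolyC_nat.
  rewrite (etrans (substD l l l (- l) (x ^+ 6) (y ^+ 6))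
    (congr2 +%R (h6 _ _ (substx _ _ _ _)) (h6 _ _ (substy _ _ _ _)))).
  have lE' : 2 * (l%:MP : {mpoly C[2]}) ^+ 6 = 1.
    by rewrite -(mpolyC_nat 2) -rmorphXn /= -mpolyCM lE mpolyC1.
  have e1 : l *: x + l *: y = l%:MP * x + l%:MP * y by rewrite 2!mul_mpolyC.
  have e2 : l *: x + (- l) *: y = l%:MP * x - l%:MP * y by rewrite 2!mul_mpolyC scaleNr.
  rewrite e1 e2; exact: (esym (Q1_A15_identity l%:MP x y lE')).
apply: similar_subst; rewrite [X in X != 0](_ : _ = - (2 * l * l)); last by ring.
by rewrite oppr_eq0 !mulf_neq0.
Qed.

(** The octahedron is itself a hexagon with a fourth matching, so [hexagon_form] identifies it with
    [sexticB] without an explicit substitution. *)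
Lemma Q2_sexticB (b : C) : b ^+ 2 = - 50 -> similar_form (Q2 R) (sexticB b).
Proof.
move=> bE; apply: (similar_trans Q2_sexticA); apply: similar_trans (similar_sym (sexticB_50 bE)).
have iE := sqrC_i; have sE := sqrC_2; rewrite (sexticA_octahedron iE sE).
have D := octahedron_det _ _ iE sE; have D' := octahedron_rot _ _ iE sE.
have D'' := octahedron_pat _ _ iE sE; have u := uniq_octahedron _ _ iE sE.
by have := hexagon_form (j := 1) u erefl D D' isT D''.
Qed.

Lemma rep_reps p t s : rep p t s -> reps p s.
Proof. by move=> [f [g [_ [_ [_ [H _]]]]]]; exists f, g. Qed.

Lemma rep_prod_lin p t s : size t = 6%N -> p != 0 -> rep p t s ->
  exists2 c, c != 0 & p = c *: prod_lin t.
Proof.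
case: t => [|t0 [|t1 [|t2 [|t3 [|t4 [|t5 []]]]]]] // _ p0.
move=> [f [g [c0 [c1 [c2 [[_ _ _ pE _] [e0 e1 e2]]]]]]].
have pc : p = (c0 * c1 * c2) *: prod_lin [:: t0; t1; t2; t3; t4; t5].
  by rewrite pE sum_cubesE e0 e1 e2 prod_lin6; exact: scaler_mul3.
exists (c0 * c1 * c2) => //; apply: contra p0 => /eqP c0'.
by rewrite pc c0' scale0r.
Qed.

Lemma prod_lin_perm t t' : perm_eq t t' -> prod_lin t = prod_lin t'.
Proof. exact: perm_big. Qed.

(** For distinct roots, admissible matchings and representations correspond bijectively: [det_rep]
    builds the map, [reps_rep] with [rep_uniq] makes it onto, [rep_matching_inj] makes it
    injective. *)
Lemma reps_card r : uniq r -> size r = 6%N ->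
  reps (prod_lin r) #= `I_(count (fun m => syzygy_det [seq r`_i | i <- m] == 0)%R matchings).
Proof.
move=> ur szr; rewrite -size_filter; set L := filter _ _.
have mapr m : m \in matchings -> perm_eq [seq r`_i | i <- m] r.
  move=> /matchings_perm pm; rewrite -[X in perm_eq _ X](mkseq_nth 0) szr.
  exact: perm_map.
have exs i : exists s, (i < size L)%N -> rep (prod_lin r) [seq r`_j | j <- nth [::] L i] s.
  have [iL|] := boolP (i < size L)%N; last by exists set0.
  have := mem_nth [::] iL; rewrite mem_filter => /andP[/eqP D hm].
  move: (nth [::] L i) D hm => m D hm; have pm := mapr _ hm.
  have um : uniq [seq r`_j | j <- m] by rewrite (perm_uniq pm).
  have szm := perm_size pm; rewrite szr in szm; have pE := esym (prod_lin_perm pm).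
  move: [seq r`_j | j <- m] D um szm pE => t D um szt pE {pm}.
  case: t szt um D pE => [|t0 [|t1 [|t2 [|t3 [|t4 [|t5 []]]]]]] // _ um D pE.
  have pE1 : prod_lin r = 1 *: (lin t0 * lin t1 * (lin t2 * lin t3) * (lin t4 * lin t5)).
    by rewrite scale1r pE; exact: prod_lin6.
  by have [s hs] := det_rep (oner_neq0 _) um pE1 D; exists s => _; exact: hs.
have [phi hphi] := choice exs.
have -> : reps (prod_lin r) = phi @` `I_(size L).
  apply/seteqP; split=> [s hs|_ [i iL <-]]; last exact: rep_reps (hphi i iL).
  have [I pI rI] := reps_rep (oner_neq0 _) szr (esym (scale1r _)) hs.
  have szI := perm_size pI; rewrite size_iota in szI.
  have cI := canonize_matchings _ pI; have /rep_canonize rc := szI.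
  have {}rI := proj2 (rc R _ _ _) rI; have D := rep_det rI.
  have inL : canonize I \in L by rewrite mem_filter cI D eqxx.
  exists (index (canonize I) L); first by rewrite /= index_mem.
  have := hphi (index (canonize I) L); rewrite index_mem nth_index // => /(_ inL) h.
  exact: rep_uniq h rI.
apply: inj_card_eq => i j; rewrite !in_setE /= => iL jL e.
have hi := hphi i iL; have hj := hphi j jL; rewrite -e in hj.
have mL (k : nat) : (k < size L)%N -> nth [::] L k \in matchings.
  by move=> kL; have := mem_nth [::] kL; rewrite mem_filter => /andP[].
have := rep_matching_inj ur szr (mL _ iL) (mL _ jL) hi hj.
by move/eqP; rewrite nth_uniq ?filter_uniq // => /eqP.
Qed.

Lemma reps_Q1 : reps (Q1 R) #= `I_4.
Proof.
apply: card_eq_trans (card_esym (reps_similar (hexagon_Q1 R))) _.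
have wE := omegaP R; have := reps_card (uniq_hexagon _ wE) erefl.
by rewrite count_hexagon.
Qed.

Lemma reps_Q2 : reps (Q2 R) #= `I_6.
Proof.
apply: card_eq_trans (reps_similar Q2_sexticA) _; rewrite (sexticA_octahedron sqrC_i sqrC_2).
have := reps_card (uniq_octahedron _ _ sqrC_i sqrC_2) erefl.
by rewrite (count_octahedron _ _ sqrC_i sqrC_2).
Qed.

Lemma meval_homog n p (v : 'I_2 -> C) : p \is n.-homog ->
  p.@[v] = \sum_(i < n.+1) (dehom p)`_i * (v ord0 ^+ i * v ord_max ^+ (n - i)).
Proof.
move/homog_sumE => {1}->; rewrite rmorph_sum; apply: eq_bigr => i _ /=.
by rewrite mevalZ mevalM !rmorphXn /= !mevalXU.
Qed.

Lemma similar_split n p : p != 0 -> p \is n.-homog ->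
  exists q c r, [/\ similar_form p q, c != 0, size r = n & q = c *: prod_lin r].
Proof.
move=> p0 hp; have dp0 : dehom p != 0.
  by apply: contra_neq p0 => d0; apply: (dehom_inj hp (rpred0 _)); rewrite d0 rmorph0.
have [e] := PreClosedField.closed_nonrootP (@solve_monicpoly _) _ dp0.
(* The substitution sends (1 : 0) to (e : 1), where p does not vanish, so the new form has no root
   at infinity. *)
rewrite /root => pe; pose q := subst e 1 1 0 p; have hq : q \is n.-homog by exact: homog_subst.
have sz : size (dehom q) = n.+1.
  apply/eqP; rewrite eqn_leq size_dehom //= ltnNge; apply/negP => sq.
  pose v := fun i : 'I_2 => if i == ord0 then 1 else 0 : C.
  have mv a b : (a *: x + b *: y).@[v] = a.
    by rewrite mevalD 2!mevalZ 2!mevalXU /v /= mulr1 mulr0 addr0.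
  have : q.@[v] = (dehom p).[e].
    rewrite /q /subst comp_mpoly_meval (meval_homog _ hp) (horner_coef_wide _ (size_dehom hp)).
    apply: eq_bigr => i _; congr (_ * _).
    by rewrite !(tnth_nth 0) /= 2!mv expr1n mulr1.
  rewrite (meval_homog _ hq) big1 => [/esym/eqP|i _]; first by rewrite (negPf pe).
  rewrite /v /= expr1n mul1r; have [iN|] := eqVneq (n - i)%N 0%N; last by rewrite expr0n =>
      /negPf->; rewrite mulr0.
  have -> : (i : nat) = n by apply/eqP; rewrite eqn_leq -ltnS ltn_ord -subn_eq0 iN.
  by rewrite nth_default // mul0r.
have [c [r [c0 szr qE]]] := homog_split hq sz.
exists q, c, r; split=> //; apply: similar_subst.
by rewrite mulr0 mul1r sub0r oppr_eq0 oner_eq0.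
Qed.

Lemma reps_neq0 p s : reps p s -> p != 0.
Proof. by move=> [f [g [_ _ nfg -> _]]]; exact: sum_cubes_neq0. Qed.

Lemma reps_4_similar p : p \is 6.-homog -> `I_4 #<= reps p ->
  similar_form p (Q1 R) \/ similar_form p (Q2 R).
Proof.
move=> hp I4.
have p0 : p != 0.
  by have /injfunPex[phi phiS _] := pcard_leP I4; exact: reps_neq0 (phiS 0%N isT).
have [q [c [r [pq c0 szr qE]]]] := similar_split p0 hp.
have q0 : q != 0.
  rewrite qE scaler_eq0 negb_or c0 /prod_lin prodf_seq_neq0; apply/allP => a _; exact: lin_neq0.
have I4q : `I_4 #<= reps q by rewrite -(card_le_eqr (reps_similar pq)).
have /injfunPex[phi phiS phiI] := pcard_leP I4q.
have exm i : exists m, (i < 4)%N -> m \in matchings /\ rep q [seq r`_j | j <- m] (phi i).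
  have [i4|] := boolP (i < 4)%N; last by exists [::].
  have [I pI rI] := reps_rep c0 szr qE (phiS i i4).
  have szI := perm_size pI; rewrite size_iota in szI.
  exists (canonize I) => _; split; first exact: canonize_matchings.
  exact: proj2 (rep_canonize _ _ _ szI) rI.
have [m hm] := choice exm.
(* Four representations have four different matchings, since one list of positions carries at most
   one representation; the roots may still repeat here. *)
have m_inj i j : (i < 4)%N -> (j < 4)%N -> m i = m j -> i = j.
  move=> i4 j4 e; have [_ hi] := hm i i4; have [_ hj] := hm j j4; rewrite e in hi.
  by apply: phiI; rewrite ?in_setE //; exact: rep_uniq hi hj.
have [||| t [j [szt j3 [h0 h1 hne h2]]]] := four_matchings (map m (iota 0 4)).
- by move=> u /mapP[i hi ->]; move: hi; rewrite mem_iota => i4; have [] := hm i i4.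
- rewrite map_inj_in_uniq ?iota_uniq // => i k; rewrite !mem_iota; exact: m_inj.
- by rewrite size_map.
have get u : size u = 6%N -> canonize u \in map m (iota 0 4) ->
    exists2 i, (i < 4)%N & canonize u = m i /\ rep q [seq r`_k | k <- u] (phi i).
  move=> szu /mapP[i hi e]; move: hi; rewrite mem_iota => i4; exists i => //; split=> //.
  apply: (proj1 (rep_canonize _ _ _ szu)); rewrite e; exact: (proj2 (hm i i4)).
have [i0 i04 [e0 r0]] := get _ szt h0.
have [|i1 i14 [e1 r1]] := get _ _ h1; first by rewrite size_rot.
have [|i2 i24 [e2 r2]] := get _ _ h2; first by rewrite size_map (perm_size (pattern_perm j3)).
pose T := [seq r`_k | k <- t]; have szT : size T = 6%N by rewrite size_map.
have r1' : rep q (rot 1 T) (phi i1) by rewrite -map_rot.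
(* Only now are the roots known to be distinct: the two side matchings carry different
   representations. *)
have uT : uniq T.
  apply: (hexagon_uniq szT r0 r1') => e; move: hne; rewrite e0 e1.
  by rewrite (phiI i0 i1) ?in_setE // eqxx.
have r2' : rep q [seq T`_k | k <- nth [::] patterns j] (phi i2).
  move: r2; rewrite /pattern -map_comp; congr rep; apply/eq_in_map => k.
  rewrite (perm_mem (pattern_perm j3)) mem_iota => k6 /=.
  by rewrite (nth_map 0%N) // szt.
have sim := hexagon_form uT szT (rep_det r0) (rep_det r1') j3 (rep_det r2').
have [d d0 qT] := rep_prod_lin szT q0 r0.
have {}sim : similar_form p (if j == 0%N then Q1 R else sexticB (5 * sqrtC (- 2))).
  apply: (similar_trans pq); apply: similar_trans sim; rewrite qT.
  by apply/similar_sym/(@similar_scale R 6) => //; exact: homog_prod_lin6.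
case: ifP sim => _ sim; [by left|right].
apply: (similar_trans sim); apply/similar_sym/Q2_sexticB.
by rewrite exprMn sqrtCK; ring.
Qed.

End Counting.

Theorem theorem5p6 (R : realType) :
  (forall p : {mpoly R[i][2]}, p \is 6.-homog ->
     (`I_4 #<= reps p <-> similar_form p (Q1 R) \/ similar_form p (Q2 R))) /\
  reps (Q1 R) #= `I_4 /\
  reps (Q2 R) #= `I_6 /\
  similar_form (Q1 R) (sexticA (0 : R[i])) /\
  similar_form (Q1 R) (sexticA (15 : R[i])) /\
  similar_form (Q1 R) (sexticB (0 : R[i])) /\
  similar_form (Q2 R) (sexticA (- 5 : R[i])) /\
  similar_form (Q2 R) (sexticB (5 * sqrtC (- 2) : R[i])) /\
  similar_form (Q2 R) (sexticB (- (5 * sqrtC (- 2)) : R[i])).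
Proof.
have b2 : (5 * sqrtC (- 2) : R[i]) ^+ 2 = - 50 by rewrite exprMn sqrtCK; ring.
split.
  move=> p hp; split; first exact: reps_4_similar.
  case=> /reps_similar/card_le_eqr ->.
    by rewrite (card_le_eqr (reps_Q1 R)).
  by rewrite (card_le_eqr (reps_Q2 R)); apply: subset_card_le => k /=; move/leq_trans; apply.
split; first exact: reps_Q1.
split; first exact: reps_Q2.
split.
  have -> : sexticA (0 : R[i]) = Q1 R by rewrite /sexticA !scale0r !addr0.
  exact: similar_refl.
split; first exact: Q1_sexticA.
split.
  have -> : sexticB (0 : R[i]) = Q1 R by rewrite /sexticB scale0r addr0.
  exact: similar_refl.
split; first exact: Q2_sexticA.
split; first exact: Q2_sexticB.
by apply: Q2_sexticB; rewrite sqrrN.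
Qed.
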